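(* Let $\omega$ be a normal state on a von Neumann algebra $\mathcal{M}$ which is faithful and tracial on a von Neumann subalgebra $\mathcal{D}$ of $\mathcal{M}$ (that is, the restriction $\omega_{|\mathcal{D}}$ is faithful and tracial). Then $$\omega(dx)=\omega(xd)\quad\text{for all } d\in\mathcal{D},\ x\in\mathcal{M},$$ if and only if there is a normal conditional expectation $\mathbb{E}_\omega$ from $\mathcal{M}$ onto $\mathcal{D}$ which preserves $\omega$. Moreover such an $\omega$-preserving normal conditional expectation onto $\mathcal{D}$ is unique, and it is faithful if $\omega$ is faithful on $\mathcal{M}$.
   Context: Von Neumann subalgebras contain the unit of the larger algebra. A conditional expectation $E:\mathcal{M}\to\mathcal{D}$ is a unital positive (equivalently, contractive) idempotent $\mathcal{D}$-module map onto $\mathcal{D}$. It is normal if it is weak* continuous, and faithful if $E(x)=0$ implies $x=0$ for $x\in\mathcal{M}_+$. It preserves $\omega$ if $\omega\circ E=\omega$ on $\mathcal{M}$. *)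

(* Defs.v *)
From HB Require Import structures.
From mathcomp Require Import all_boot all_order all_algebra.
From mathcomp Require Import sesquilinear complex.
From mathcomp Require Import all_classical all_reals all_analysis.

Set Implicit Arguments.
Unset Strict Implicit.
Unset Printing Implicit Defensive.

Import Order.TTheory GRing.Theory Num.Theory Num.Def.
Import numFieldNormedType.Exports.

Local Open Scope classical_set_scope.
Local Open Scope ring_scope.
Local Open Scope complex_scope.

(* [{dot H for conjC}] is linear in its first argument and conjugate-linear
   in its second one. *)
HB.mixin Record CompleteNormedModule_isHilbert (R : realType) H
    of CompleteNormedModule R[i] H := {
  hdot : {dot H for (@conjC R[i])} ;
  hdot_norm : forall u : H, `|u| ^+ 2 = hdot u u }.

#[short(type="hilbertType")]
HB.structure Definition Hilbert (R : realType) :=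
  {H of CompleteNormedModule R[i] H & CompleteNormedModule_isHilbert R H}.

Section Operators.
Context {R : realType} {H : hilbertType R}.
Implicit Types (a b : H -> H) (S M D : set (H -> H)).

(* Operators are bare functions, with the pointwise module structure of
   [H -> H], composition as product and [idfun] as unit; the elements of B(H)
   are singled out by [bounded_op]. Maps defined on an algebra [M] are total on
   [H -> H], and only their values on [M] matter. *)
Definition bounded_op a := linear a /\ continuous a.

Definition is_adjoint a b := forall u v : H, hdot (a u) v = hdot u (b v).

Definition positive_op a := forall u : H, 0 <= hdot (a u) u.

Definition commutant S : set (H -> H) :=
  [set b | bounded_op b /\ forall a, S a -> a \o b = b \o a].

(* A commutant is a unital subalgebra of B(H), so the last clause makes [M] a
   unital subalgebra too. *)
Definition von_neumann_algebra M :=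
  [/\ (forall a, M a -> bounded_op a),
      (forall a, M a -> exists2 b, M b & is_adjoint a b) &
      commutant (commutant M) = M].

(* Since all algebras considered contain the identity operator of [H], a von
   Neumann subalgebra of [M] is a smaller von Neumann algebra on [H]. *)
Definition von_neumann_subalgebra D M := von_neumann_algebra D /\ D `<=` M.

Definition sq_summable (xi : nat -> H) :=
  cvgn (series (fun n => `|xi n| ^+ 2 : R[i]^o)).

(* The weak* continuous functionals on B(H), that is, the elements of its
   predual, are the functionals x |-> \sum_n <x xi_n, eta_n> with xi and eta
   square-summable. *)
Definition predual_functional (p : (nat -> H) * (nat -> H)) a : R[i]^o :=
  limn (series (fun n => hdot (a (p.1 n)) (p.2 n) : R[i]^o)).

Definition predual_index :=
  {p : (nat -> H) * (nat -> H) | sq_summable p.1 /\ sq_summable p.2}.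

(* The weak* (sigma-weak) topology. It is only meaningful on B(H), as the
   series above may diverge elsewhere; it is used only through the subspace
   topology of an algebra of bounded operators. *)
Definition weak_star : Type :=
  sup_topology (fun i : predual_index =>
    Topological.class (initial_topology (predual_functional (sval i)))).

HB.instance Definition _ := Topological.on weak_star.

Definition linear_on (V W : lmodType R[i]) (A : set V) (f : V -> W) :=
  forall (k : R[i]) (u v : V), A u -> A v -> f (k *: u + v) = k *: f u + f v.

Definition normal_functional M (w : (H -> H) -> R[i]^o) :=
  {within M : set weak_star, continuous (w : weak_star -> R[i]^o)}.

Definition normal_map M (E : (H -> H) -> (H -> H)) :=
  {within M : set weak_star, continuous (E : weak_star -> weak_star)}.

Definition is_state M (w : (H -> H) -> R[i]^o) :=
  [/\ linear_on M w,
      (forall x, M x -> positive_op x -> 0 <= w x :> R[i]) &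
      w idfun = 1].

Definition normal_state M w := is_state M w /\ normal_functional M w.

Definition tracial_on D (w : (H -> H) -> R[i]^o) :=
  forall a b, D a -> D b -> w (a \o b) = w (b \o a).

Definition faithful_on (W : lmodType R[i]) M (f : (H -> H) -> W) :=
  forall x, M x -> positive_op x -> f x = 0 -> x = 0.

Definition conditional_expectation M D (E : (H -> H) -> (H -> H)) :=
  [/\ linear_on M E /\ E @` M = D,
      E idfun = idfun,
      (forall x, M x -> positive_op x -> positive_op (E x)),
      (forall x, M x -> E (E x) = E x) &
      (forall d x, D d -> M x ->
         E (d \o x) = d \o E x /\ E (x \o d) = E x \o d)].

Definition preserves M (w : (H -> H) -> R[i]^o) (E : (H -> H) -> (H -> H)) :=
  forall x, M x -> w (E x) = w x.

Definition preserving_normal_expectation M D w E :=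
  [/\ conditional_expectation M D E, normal_map M E & preserves M w E].

End Operators.

Arguments weak_star {R} H.

(* Main.v *)
Require Import Defs.
From HB Require Import structures.
From mathcomp Require Import all_boot all_order all_algebra.
From mathcomp Require Import sesquilinear complex.
From mathcomp Require Import all_classical all_reals all_analysis.
From mathcomp Require Import ring lra.

(* A normal positive w is dominated on M by a vector functional x |-> <x c, c>,
   where c is a square-summable sequence of vectors. Such a domination upgrades
   to an equality phi = <. d, d> for every positive functional phi on M
   (Radon-Nikodym: phi(y^* x) = <T x c, y c> with T commuting with M, and
   d = T^(1/2) c). So w = <. zeta, zeta>, and w being faithful on D, the vectors
   u such that <d u, u> <= C w(d) for all positive d in D are dense in H.

   Existence. For 0 <= x <= 1 in M, minimise w((h - x)^2) over the h in D with
   0 <= h <= 1. As w(d x) = w(x d), truncating a self-adjoint a in D to [0, 1]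
   does not increase w((a - x)^2), so this infimum is also the one over all
   self-adjoint elements of D, where it is characterised by w(x d) = w(h d). It is
   attained: a minimising sequence converges on zeta, hence on the dense set of
   vectors above, hence strongly.

   Normality. If u is one of these vectors, <E(x) u, u> <= C w(E x) = C w(x) on
   positive x, so this functional is <. c, c> with |c| = |u|. An arbitrary u is
   the sum of a rapidly converging series of such vectors, hence <E(.) u, u> is
   dominated by a vector functional; then so is its sum over a square-summable
   sequence of vectors u, and polarisation gives all functionals of the predual. *)

Set Implicit Arguments.
Unset Strict Implicit.
Unset Printing Implicit Defensive.

Import Order.TTheory GRing.Theory Num.Theory.
Import numFieldNormedType.Exports.
Local Open Scope classical_set_scope.
Local Open Scope ring_scope.
Local Open Scope complex_scope.

(** Spectral theory is replaced by Hilbert space arguments. Square roots come from a polynomial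
    iteration, positive parts from the square root of [a^2], and Riesz representation, projections
    and the expectation itself from one lemma on minimising sequences.

    A weak* functional involves infinitely many vectors, so most of the work takes place in the
    space of square-summable sequences, where [x] acts coordinatewise and a predual functional is a
    single matrix coefficient.

    The expectation is pinned down by [w (x \o d) = w (h \o d)] for all [d] in [D]. This relation is
    linear in the pair [x], [h] and has at most one solution [h] in [D], so linearity, the module
    laws and uniqueness reduce to it; existence and positivity need the minimisation. The
    restriction [0 <= h <= 1] supplies the uniform bound that turns convergence on a dense set into
    strong convergence. Its price is the truncation argument: such [h] do not form a subspace, and
    first-order variations leave the set. *)

Lemma eq_cvgn (T : topologicalType) (f g : nat -> T) (l : T) :
  f =1 g -> f n @[n --> \oo] --> l -> g n @[n --> \oo] --> l.
Proof. by move=> /funext->. Qed.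

(** The source of the Cauchy-Schwarz bounds below and, with [a] a small or zero error, of the
    first-order optimality conditions. *)
Lemma discriminant_le0 (R : realType) (a b c : R) :
  (forall t, 0 <= a + 2 * t * b + t ^+ 2 * c) -> b ^+ 2 <= a * c.
Proof.
move=> h; have a0 : 0 <= a by have := h 0; rewrite mulr0 mul0r expr0n mul0r !addr0.
have [c0|c0|c0] := ltgtP c 0.
- have := normr_ge0 b; set B := `|b| => B0.
  have /andP[b1 b2] : - B <= b <= B by rewrite -ler_norml.
  have cc : 0 < - c by lra.
  (* At [t = - M], the bounds [1 <= M] and [a + 1 + 2 * B <= M * - c] make the quadratic at most
     [-1], so a negative leading coefficient is impossible. *)
  have := h (- (Num.max 1 ((a + 1 + 2 * B) / - c))).
  set M := Num.max _ _.
  have M1 : 1 <= M by rewrite le_max lexx.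
  have M2 : (a + 1 + 2 * B) / - c <= M by rewrite le_max lexx orbT.
  move: M2; rewrite ler_pdivrMr// => M2.
  nra.
- have := h (- b / c).
  have -> : a + 2 * (- b / c) * b + (- b / c) ^+ 2 * c = a - b ^+ 2 / c.
    by field; rewrite gt_eqF.
  by rewrite subr_ge0 ler_pdivrMr.
- rewrite c0 mulr0; have [->|b0] := eqVneq b 0; first by rewrite expr0n.
  have := h (- (a + 1) / (2 * b)); rewrite c0.
  have -> : a + 2 * (- (a + 1) / (2 * b)) * b + (- (a + 1) / (2 * b)) ^+ 2 * 0 = -1.
    by field.
  lra.
Qed.

(** * Real inner products and norm convergence *)

Section HilbertSpaces.
Variable R : realType.
Implicit Types (r s t : R).

(* Only the real part of the inner product is used: it determines the norm, the
   adjoints and the orthogonal complements of complex subspaces. *)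
Record hilbert (V : lmodType R[i]) (ip : V -> V -> R) : Prop := Hilbert {
  ipC : forall u v, ip u v = ip v u;
  ipL : forall r u v w, ip (r%:C *: u + v) w = r * ip u w + ip v w;
  ip_ge0 : forall u, 0 <= ip u u;
  ip_eq0 : forall u, ip u u = 0 -> u = 0;
  ip_complete : forall u : nat -> V,
    (forall e, 0 < e -> exists N, forall n m, (N <= n)%N -> (N <= m)%N ->
      ip (u n - u m) (u n - u m) < e) ->
    exists l, ip (u n - l) (u n - l) @[n --> \oo] --> (0 : R) }.

Section Theory.
Variables (V : lmodType R[i]) (ip : V -> V -> R) (ipP : hilbert ip).
Implicit Types (u v w l : V) (T X : V -> V).

Local Notation nsq u := (ip u u).

Lemma ipDl u v w : ip (u + v) w = ip u w + ip v w.
Proof. by have := ipL ipP 1 u v w; rewrite scale1r mul1r. Qed.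

Lemma ip0l w : ip 0 w = 0.
Proof. by apply: (addrI (ip 0 w)); rewrite -ipDl !addr0. Qed.

Lemma ipZl r u w : ip (r%:C *: u) w = r * ip u w.
Proof. by have := ipL ipP r u 0 w; rewrite addr0 ip0l addr0. Qed.

Lemma ipNl u w : ip (- u) w = - ip u w.
Proof. by apply/eqP; rewrite -subr_eq0 opprK -ipDl addNr ip0l. Qed.

Lemma ipDr u v w : ip w (u + v) = ip w u + ip w v.
Proof. by rewrite !(ipC ipP w) ipDl. Qed.

Lemma ip0r w : ip w 0 = 0.
Proof. by rewrite (ipC ipP) ip0l. Qed.

Lemma ipZr r u w : ip w (r%:C *: u) = r * ip w u.
Proof. by rewrite !(ipC ipP w) ipZl. Qed.

Lemma ipNr u w : ip w (- u) = - ip w u.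
Proof. by rewrite !(ipC ipP w) ipNl. Qed.

Definition ipE := (ipDl, ipDr, ipNl, ipNr, ipZl, ipZr, ip0l, ip0r).

Lemma ip_inj u v : (forall w, ip u w = ip v w) -> u = v.
Proof.
move=> h; apply/eqP; rewrite -subr_eq0; apply/eqP/(ip_eq0 ipP).
by rewrite ipDl ipNl h subrr.
Qed.

Lemma cauchy_schwarz u v : ip u v ^+ 2 <= nsq u * nsq v.
Proof.
apply: discriminant_le0 => t; have := ip_ge0 ipP (u + t%:C *: v).
by rewrite !ipE (ipC ipP v u); congr (_ <= _); ring.
Qed.

Lemma nsqN u : nsq (- u) = nsq u.
Proof. by rewrite !ipE opprK. Qed.

Lemma nsqZ r u : nsq (r%:C *: u) = r ^+ 2 * nsq u.
Proof. by rewrite !ipE mulrA. Qed.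

Lemma nsqD_le u v : nsq (u + v) <= 2 * nsq u + 2 * nsq v.
Proof.
have := ip_ge0 ipP (u - v); rewrite !ipE (ipC ipP v u); lra.
Qed.

Lemma nsqB_le w u v : nsq (u - v) <= 2 * nsq (u - w) + 2 * nsq (v - w).
Proof.
rewrite -(nsqN (v - w)) opprB; have -> : u - v = (u - w) + (w - v).
  by rewrite addrA subrK.
exact: nsqD_le.
Qed.

Definition hconv (u : nat -> V) l := nsq (u n - l) @[n --> \oo] --> (0 : R).

Lemma hconv_cst l : hconv (fun=> l) l.
Proof. by rewrite /hconv subrr ip0l; exact: cvg_cst. Qed.

Lemma hconv_le (u : nat -> V) l (b : nat -> R) C :
  (forall n, nsq (u n - l) <= C * b n) -> b n @[n --> \oo] --> (0 : R) ->
  hconv u l.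
Proof.
move=> ub b0; apply: (@squeeze_cvgr _ _ _ _ (fun=> 0) (fun n => C * b n)).
- by near=> n; rewrite ip_ge0// ub.
- exact: cvg_cst.
- by rewrite -(mulr0 C); apply: cvgM => //; exact: cvg_cst.
Unshelve. all: by end_near. Qed.

Lemma hconvD (u v : nat -> V) l k :
  hconv u l -> hconv v k -> hconv (fun n => u n + v n) (l + k).
Proof.
move=> ul vk.
apply: (hconv_le (C := 2) (b := fun n => nsq (u n - l) + nsq (v n - k))).
  by move=> n; rewrite opprD addrACA mulrDr; exact: nsqD_le.
by rewrite -(addr0 0); exact: cvgD.
Qed.

Lemma hconvN (u : nat -> V) l : hconv u l -> hconv (fun n => - u n) (- l).
Proof.
by move=> ul; apply: (hconv_le (C := 1) _ ul) => n; rewrite -opprD nsqN mul1r.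
Qed.

Lemma hconv_map T C (u : nat -> V) l :
  (forall v w, T (v - w) = T v - T w) -> (forall v, nsq (T v) <= C * nsq v) ->
  hconv u l -> hconv (T \o u) (T l).
Proof.
by move=> TB Tb ul; apply: (hconv_le (C := C) _ ul) => n /=; rewrite -TB.
Qed.

Lemma hconvZ r (u : nat -> V) l :
  hconv u l -> hconv (fun n => r%:C *: u n) (r%:C *: l).
Proof.
move=> ul; apply: (hconv_map (T := *:%R r%:C) (C := r ^+ 2) _ _ ul) => [v w|v].
  by rewrite scalerBr.
by rewrite nsqZ.
Qed.

Lemma cvg_sqr0 (a : nat -> R) : a n ^+ 2 @[n --> \oo] --> (0 : R) ->
  a n @[n --> \oo] --> (0 : R).
Proof.
move=> a0; apply/cvgr0Pnorm_lt => e e0.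
move/cvgr0Pnorm_lt : a0 => /(_ (e ^+ 2)) h.
near=> n; rewrite -(@ltr_pXn2r _ 2)// ?nnegrE ?normr_ge0//; last exact: ltW.
rewrite -normrX; near: n; apply: h; exact: exprn_gt0.
Unshelve. all: by end_near. Qed.

Lemma hconv_ip (u : nat -> V) l w :
  hconv u l -> ip (u n) w @[n --> \oo] --> ip l w.
Proof.
move=> ul; apply/subr_cvg0.
have h : ip (u n - l) w ^+ 2 @[n --> \oo] --> (0 : R).
  apply: (@squeeze_cvgr _ _ _ _ (fun=> 0) (fun n => nsq (u n - l) * nsq w)).
  - by near=> n; rewrite sqr_ge0 cauchy_schwarz.
  - exact: cvg_cst.
  - by rewrite -(mul0r (nsq w)); apply: cvgM => //; exact: cvg_cst.
by apply: eq_cvgn (cvg_sqr0 h) => n; rewrite !ipE.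
Unshelve. all: by end_near. Qed.

(** Squared norms are continuous, by expanding [nsq (x n + y n - c)]; polarisation carries this over
    to inner products. *)
Lemma hconv_ip2 (u v : nat -> V) l k :
  hconv u l -> hconv v k -> ip (u n) (v n) @[n --> \oo] --> ip l k.
Proof.
move=> ul vk.
have key (x y : nat -> V) a b : hconv x a -> hconv y b ->
    nsq (x n + y n) @[n --> \oo] --> nsq (a + b).
  move=> xa yb; have xyab := hconvD xa yb; set c := a + b in xyab *.
  have h : nsq (x n + y n - c) + 2 * ip (x n + y n) c - nsq c @[n --> \oo]
      --> 0 + 2 * nsq c - nsq c.
    apply: cvgB; last exact: cvg_cst.
    by apply: cvgD => //; apply: cvgM; [exact: cvg_cst|exact: hconv_ip].
  have -> : nsq c = 0 + 2 * nsq c - nsq c by ring.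
  apply: eq_cvgn h => n.
  by move: (x n + y n) c {xyab} => z c; rewrite !ipE (ipC ipP c z); ring.
have h : (nsq (u n + v n) - nsq (u n - v n)) * 4^-1 @[n --> \oo]
    --> (nsq (l + k) - nsq (l - k)) * 4^-1.
  apply: cvgM; last exact: cvg_cst.
  apply: cvgB; first exact: key.
  by apply: key => //; exact: hconvN.
have -> : ip l k = (nsq (l + k) - nsq (l - k)) * 4^-1.
  by rewrite !ipE (ipC ipP k l); field.
by apply: eq_cvgn h => n; rewrite !ipE (ipC ipP (v n) (u n)); field.
Qed.

Lemma hconv_nsq (u : nat -> V) l : hconv u l -> nsq (u n) @[n --> \oo] --> nsq l.
Proof. by move=> ul; exact: hconv_ip2. Qed.

Lemma hconv_unique (u : nat -> V) l k : hconv u l -> hconv u k -> l = k.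
Proof.
move=> ul uk; apply: ip_inj => w.
exact: cvg_unique (hconv_ip (w := w) ul) (hconv_ip (w := w) uk).
Qed.

Lemma hconv_of_cauchy (u : nat -> V) (a : nat -> R) :
  (forall n m, (n <= m)%N -> nsq (u n - u m) <= a n) ->
  a n @[n --> \oo] --> (0 : R) -> exists l, hconv u l.
Proof.
move=> ua a0; apply: (ip_complete ipP) => e e0.
have /cvgr0Pnorm_lt/(_ (e / 4)) := a0.
case; first by lra.
move=> N _ hN; exists N => n m Nn Nm.
have := @nsqB_le (u N) (u n) (u m).
rewrite -(nsqN (u n - u N)) -(nsqN (u m - u N)) !opprB.
have := ua _ _ Nn; have := ua _ _ Nm.
have := hN N (leqnn N); have := ler_norm (a N); lra.
Qed.

End Theory.
End HilbertSpaces.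

(** * Minimisation, projections and square roots *)

Section Theory.
Variables (R : realType) (V : lmodType R[i]) (ip : V -> V -> R) (ipP : hilbert ip).
Implicit Types (u v w l : V) (T X : V -> V) (r s t : R).

Local Notation nsq u := (ip u u).
Local Notation hconv := (hconv ip).
Local Notation ipE := (ipE ipP).

(** By the parallelogram identity, [nsq (e a - e b)] is four times the gap between the mean of
    [G a], [G b] and [G (mid a b)], so almost minimal points are close. Only midpoints are required
    of [A], which may be a subspace or the operators between 0 and 1; [e] need not be injective. *)
Lemma minimizing_sequence (X : Type) (A : set X) (mid : X -> X -> X)
    (e : X -> V) (F : X -> R) (m : R) :
  let G x := nsq (e x) - 2 * F x in
  A !=set0 ->
  (forall a b, A a -> A b -> [/\ A (mid a b),
     e (mid a b) = (2^-1)%:C *: (e a + e b) & F (mid a b) = (F a + F b) / 2]) ->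
  (forall a, A a -> m <= G a) ->
  exists x l, [/\ forall n, A (x n), hconv (e \o x) l &
    forall n a, A a -> G (x n) <= G a + n.+1%:R^-1].
Proof.
move=> G [a0 Aa0] midP mG.
have infG : has_inf (G @` A).
  by split; [exists (G a0), a0|exists m => _ [a Aa <-]; exact: mG].
have /choice[x xP] n : exists x, A x /\ G x < inf (G @` A) + n.+1%:R^-1.
  have n0 : 0 < n.+1%:R^-1 :> R by rewrite invr_gt0 ltr0n.
  by have [_ [x Ax <-] xn] := inf_adherent n0 infG; exists x.
have Ginf a : A a -> inf (G @` A) <= G a.
  by move=> Aa; apply: ge_inf; [case: infG|exists a].
have [l xl] : exists l, hconv (e \o x) l.
  have h : 4 * n.+1%:R^-1 @[n --> \oo] --> (0 : R).
    by rewrite -(mulr0 4); apply: cvgM; [exact: cvg_cst|exact: cvg_harmonic].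
  apply: (hconv_of_cauchy ipP _ h) => n k nk /=.
  have [[An Gn] [Ak Gk]] := (xP n, xP k).
  have [Am em Fm] := midP _ _ An Ak.
  have := Ginf _ Am; rewrite /G em Fm => hm.
  have : k.+1%:R^-1 <= n.+1%:R^-1 :> R.
    by rewrite lef_pV2 ?posrE ?ltr0n// ler_nat ltnS.
  move: hm Gn Gk; rewrite /G !ipE (ipC ipP (e (x k)) (e (x n))).
  move: (n.+1%:R^-1) (k.+1%:R^-1) (inf _) => i j ii.
  set a := ip _ _; set b := ip _ _; set c := ip _ (e (x k)); lra.
exists x, l; split=> [n||n a Aa] //; first by have [] := xP n.
by have [_ /ltW h] := xP n; rewrite (le_trans h)// lerD2r Ginf.
Qed.

Definition real_subspace (X : lmodType R[i]) (A : set X) :=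
  A 0 /\ forall r a b, A a -> A b -> A (r%:C *: a + b).

Definition real_linear_on (X Y : lmodType R[i]) (A : set X) (f : X -> Y) :=
  forall r a b, A a -> A b -> f (r%:C *: a + b) = r%:C *: f a + f b.

Definition limit_of (X : Type) (A : set X) (e : X -> V) l :=
  exists x, (forall n, A (x n)) /\ hconv (e \o x) l.

(** Minimises [nsq (e a) - 2 * F a], which the bound on [F] keeps above [- C]. Neither completeness
    of [A] nor injectivity of [e] enters: the representing vector is found in the closure of [e(A)],
    which is recorded for later uniqueness arguments. *)
Lemma riesz (X : lmodType R[i]) (A : set X) (e : X -> V) (F : X -> R) C :
  real_subspace A -> real_linear_on A e ->
  (forall r a b, A a -> A b -> F (r%:C *: a + b) = r * F a + F b) ->
  0 <= C -> (forall a, A a -> F a ^+ 2 <= C * nsq (e a)) ->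
  exists l, limit_of A e l /\
    forall a, A a -> ip (e a) l = F a.
Proof.
move=> [A0 AL] eL FL C0 FC.
have FZ r a : A a -> F (r%:C *: a) = r * F a.
  move=> Aa; have := FL r _ _ Aa A0; rewrite addr0 => ->.
  have := FL 1 _ _ A0 A0; rewrite scaler0 addr0 mul1r; lra.
have eZ r a : A a -> e (r%:C *: a) = r%:C *: e a.
  move=> Aa; have := eL r _ _ Aa A0; rewrite addr0 => ->.
  have := eL 1 _ _ A0 A0; rewrite !scale1r addr0 => /eqP.
  by rewrite -subr_eq0 opprD addrA subrr add0r oppr_eq0 => /eqP->; rewrite addr0.
have AZ r a : A a -> A (r%:C *: a).
  by move=> Aa; have := AL r _ _ Aa A0; rewrite addr0.
have [|||x [l [Ax xl xmin]]] := @minimizing_sequence X A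
    (fun a b => (2^-1)%:C *: ((1 : R)%:C *: a + b)) e F (- C).
- by exists 0.
- move=> a b Aa Ab; have Aab := AL 1 _ _ Aa Ab; split.
  + exact: AZ.
  + by rewrite eZ// eL// !scale1r.
  + by rewrite FZ// FL// mul1r mulrC.
- move=> a Aa; have := FC a Aa; have := ip_ge0 ipP (e a).
  move: (ip _ _) (F a) => N f N0 fC.
  suff : 2 * f <= N + C by lra.
  rewrite leNgt; apply/negP => h.
  have : (N + C) * (N + C) < (2 * f) * (2 * f) by apply: ltr_pM => //; lra.
  have := sqr_ge0 (N - C); nra.
exists l; split; first by exists x.
move=> a Aa; rewrite (ipC ipP).
suff h : ip (e (x n)) (e a) @[n --> \oo] --> F a.
  exact: cvg_unique (hconv_ip ipP (w := e a) xl) h.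
apply/subr_cvg0; apply: cvg_sqr0.
apply: (@squeeze_cvgr _ _ _ _ (fun=> 0) (fun n => n.+1%:R^-1 * nsq (e a))).
(* Almost minimality of [x n] against [t a + x n] is a quadratic inequality in [t] with constant
   term [1 / (n + 1)]; its discriminant bounds the defect in the Riesz identity. *)
- near=> n; rewrite sqr_ge0 /=; apply: discriminant_le0 => t.
  have := xmin n _ (AL t _ _ Aa (Ax n)); rewrite eL// FL// !ipE.
  rewrite (ipC ipP (e a) (e (x n))) /=.
  by move: n.+1%:R^-1 => i h; rewrite -subr_ge0 in h; apply: le_trans h _;
     rewrite le_eqVlt; apply/orP; left; apply/eqP; ring.
- exact: cvg_cst.
- rewrite -(mul0r (nsq (e a))); apply: cvgM; last exact: cvg_cst.
  exact: cvg_harmonic.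
Unshelve. all: by end_near. Qed.

Lemma orthogonal_projection (S : set V) u : real_subspace S ->
  exists p, limit_of S id p /\
    forall x, S x -> ip x p = ip x u.
Proof.
move=> Ssub; apply: (@riesz _ S id (ip ^~ u) (nsq u)) => //.
- by move=> r a b _ _; rewrite !ipE.
- exact: ip_ge0.
- by move=> a _; rewrite mulrC; exact: cauchy_schwarz.
Qed.

Definition symmetric_op T := forall u v, ip (T u) v = ip u (T v).

Lemma symmetric_opL T : symmetric_op T -> real_linear_on setT T.
Proof.
move=> Ts r u v _ _; apply: (ip_inj ipP) => w.
by rewrite Ts !ipE !Ts.
Qed.

Lemma cvgn_le (a b : nat -> R) (x y : R) : (forall n, a n <= b n) ->
  a n @[n --> \oo] --> x -> b n @[n --> \oo] --> y -> x <= y.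
Proof.
move=> ab ax yb; rewrite -subr_ge0.
have h : b n - a n @[n --> \oo] --> y - x by exact: cvgB.
by apply: (cvgr_to_ge h); near=> n; rewrite subr_ge0.
Unshelve. all: by end_near. Qed.

Section RealLinear.
Variables (W : lmodType R[i]) (T : V -> W) (Tl : real_linear_on setT T).

Lemma rlD u v : T (u + v) = T u + T v.
Proof. by have := Tl 1 (a := u) (b := v) I I; rewrite !scale1r. Qed.

Lemma rl0 : T 0 = 0.
Proof. by apply: (addrI (T 0)); rewrite -rlD !addr0. Qed.

Lemma rlZ r u : T (r%:C *: u) = r%:C *: T u.
Proof. by have := Tl r (a := u) (b := 0) I I; rewrite !addr0 rl0 addr0. Qed.

Lemma rlN u : T (- u) = - T u.
Proof. by apply: (addrI (T u)); rewrite -rlD !subrr rl0. Qed.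

Lemma rlB u v : T (u - v) = T u - T v.
Proof. by rewrite rlD rlN. Qed.

End RealLinear.

Lemma psd_cauchy_schwarz T u v : symmetric_op T -> (forall w, 0 <= ip (T w) w) ->
  ip (T u) v ^+ 2 <= ip (T u) u * ip (T v) v.
Proof.
move=> Ts T0; apply: discriminant_le0 => t; have := T0 (u + t%:C *: v).
have Tl := symmetric_opL Ts.
rewrite rlD// rlZ// !ipE (Ts v u) (ipC ipP v (T u)).
by congr (_ <= _); ring.
Qed.

(** Cauchy-Schwarz for the form [<T u, v>] at [v = T u], divided by [nsq (T u)]. *)
Lemma nsq_symmetric_le T C : symmetric_op T ->
  (forall u, 0 <= ip (T u) u <= C * nsq u) ->
  forall u, nsq (T u) <= C * ip (T u) u.
Proof.
move=> Ts T01 u; have T0 w : 0 <= ip (T w) w by case/andP: (T01 w).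
have := psd_cauchy_schwarz u (T u) Ts T0.
have /andP[h1 h2] := T01 (T u); have := ip_ge0 ipP (T u).
have := T0 u; set a := ip (T u) u => a0; set b := nsq (T u) => b0.
rewrite -/b in h2; move: h1 h2; set c := ip (T _) _ => h1 h2 h3.
have [->|bn0] := eqVneq b 0; last first.
  have bp : 0 < b by rewrite lt0r bn0.
  have : b * b <= (C * a) * b by rewrite -expr2 (le_trans h3)//; nra.
  by rewrite ler_pM2r.
(* No sign of [C] is assumed, but [0 < a <= C * nsq u] forces it to be positive. *)
have [aE|an0] := eqVneq a 0; first by rewrite aE mulr0.
have /andP[_] := T01 u; have := ip_ge0 ipP u; rewrite -/a => ? ?.
have ap : 0 < a by rewrite lt0r an0.
have up : 0 < nsq u.
  rewrite lt0r (ip_ge0 ipP) andbT; apply/eqP => u0.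
  by move: ap; rewrite /a (ip_eq0 ipP u0) ip0r// ltxx.
nra.
Qed.

(** The kernel of [T] is orthogonal to its range and does not contribute to the form, so [u] may be
    replaced by its projection [v] on the closure of the range. This makes it possible to recognise
    positive parts by testing them on their own range. *)
Lemma symmetric_range_le T C k : symmetric_op T ->
  (forall u, nsq (T u) <= C * nsq u) -> 0 <= k ->
  (forall u, ip (T (T u)) (T u) <= k * nsq (T u)) ->
  forall u, ip (T u) u <= k * nsq u.
Proof.
move=> Ts TC k0 Tk u; have Tl := symmetric_opL Ts.
have Ssub : real_subspace (range T).
  split; first by exists 0 => //; rewrite rl0.
  by move=> r _ _ [a _ <-] [b _ <-]; exists (r%:C *: a + b) => //; rewrite Tl.
have [v [[x [xS xv] vu]]] := orthogonal_projection u Ssub.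
have /choice[y yx] n : exists y, T y = x n by have [y _ <-] := xS n; exists y.
have Tuv : T u = T v.
  by apply: (ip_inj ipP) => w; rewrite !Ts !(ipC ipP _ (T _)) vu//; exists w.
have vvu : nsq v = ip v u.
  suff h : ip (x n) v @[n --> \oo] --> ip v u.
    exact: cvg_unique (hconv_ip ipP (w := v) xv) h.
  apply: (eq_cvgn (f := fun n => ip (x n) u)); last exact: (hconv_ip ipP xv).
  by move=> n; rewrite vu.
have vleu : nsq v <= nsq u.
  have := cauchy_schwarz ipP v u; rewrite -vvu expr2.
  have := ip_ge0 ipP v; rewrite le_eqVlt => /orP[/eqP<- _|v0].
    exact: ip_ge0.
  by rewrite ler_pM2l.
apply: (le_trans _ (ler_wpM2l k0 vleu)).
rewrite Tuv -vu; last by exists v.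
apply: (@cvgn_le (fun n => ip (T (x n)) (x n)) (fun n => k * nsq (x n))).
- by move=> n; rewrite -yx.
- apply: (hconv_ip2 ipP) => //.
  by apply: (hconv_map ipP (C := C)) => //; exact: rlB.
- by apply: cvgM; [exact: cvg_cst|exact: (hconv_nsq ipP xv)].
Qed.

(** As [l] is a limit of vectors [e (x n)], the bound on [F] passes to [l] itself:
    [nsq l ^+ 2 <= C * nsq l]. *)
Lemma limit_of_bound (X : Type) (A : set X) (e : X -> V) (F : X -> R) C l :
  0 <= C ->
  limit_of A e l -> (forall a, A a -> ip (e a) l = F a) ->
  (forall a, A a -> F a ^+ 2 <= C * nsq (e a)) -> nsq l <= C.
Proof.
move=> C0 [x [Ax xl]] lF FC.
have h1 : ip (e (x n)) l ^+ 2 @[n --> \oo] --> nsq l ^+ 2.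
  by rewrite expr2; apply: cvgM; exact: (hconv_ip ipP xl).
have h2 : C * nsq (e (x n)) @[n --> \oo] --> C * nsq l.
  by apply: cvgM; [exact: cvg_cst|exact: (hconv_nsq ipP xl)].
have : nsq l ^+ 2 <= C * nsq l.
  apply: (cvgn_le _ h1 h2) => n; rewrite lF//; exact: FC.
have := ip_ge0 ipP l; rewrite le_eqVlt => /orP[/eqP<-//|l0].
by rewrite expr2 ler_pM2r.
Qed.

Section LimitOf.
Variables (X : lmodType R[i]) (A : set X) (e : X -> V).
Hypotheses (Asub : real_subspace A) (eL : real_linear_on A e).

Lemma limit_ofI a : A a -> limit_of A e (e a).
Proof. by move=> Aa; exists (fun=> a); split=> //; exact: (hconv_cst ipP). Qed.

Lemma limit_ofL r l k : limit_of A e l -> limit_of A e k ->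
  limit_of A e (r%:C *: l + k).
Proof.
move=> [x [Ax xl]] [y [Ay yk]]; exists (fun n => r%:C *: x n + y n); split.
  by move=> n; case: Asub => _; apply.
have -> : e \o (fun n => r%:C *: x n + y n) = fun n => r%:C *: e (x n) + e (y n).
  by apply/funext => n /=; rewrite eL.
by apply: (hconvD ipP) => //; exact: (hconvZ ipP).
Qed.

Lemma limit_of_orth l v : limit_of A e l -> (forall a, A a -> ip (e a) v = 0) ->
  ip l v = 0.
Proof.
move=> [x [Ax xl]] ev.
have h : ip (e (x n)) v @[n --> \oo] --> (0 : R).
  by apply: (eq_cvgn (f := fun=> 0)) => [n|]; [rewrite ev|exact: cvg_cst].
exact: cvg_unique (hconv_ip ipP (w := v) xl) h.
Qed.

(** [l - k] lies in the closure of [e(A)] and is orthogonal to it. *)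
Lemma limit_of_unique l k : limit_of A e l -> limit_of A e k ->
  (forall a, A a -> ip (e a) l = ip (e a) k) -> l = k.
Proof.
move=> hl hk h; apply/eqP; rewrite -subr_eq0; apply/eqP/(ip_eq0 ipP).
apply: limit_of_orth => [|a Aa]; last by rewrite !ipE h// subrr.
by have := limit_ofL (-1) hk hl; rewrite rmorphN scaleN1r addrC.
Qed.

End LimitOf.

End Theory.

Section Theory.
Variables (R : realType) (V : lmodType R[i]) (ip : V -> V -> R) (ipP : hilbert ip).
Implicit Types (u v w l : V) (T X : V -> V) (r s t : R).

Local Notation nsq u := (ip u u).
Local Notation hconv := (hconv ip).
Local Notation ipE := (ipE ipP).
Local Notation symmetric_op := (symmetric_op ip).

Lemma ip_le_of_nsq r s u v w : 0 <= r -> 0 <= s ->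
  nsq u <= r ^+ 2 * nsq w -> nsq v <= s ^+ 2 * nsq w -> ip u v <= r * s * nsq w.
Proof.
move=> r0 s0 ur vs; have w0 := ip_ge0 ipP w.
have h : ip u v ^+ 2 <= (r * s * nsq w) ^+ 2.
  apply: le_trans (cauchy_schwarz ipP u v) _.
  rewrite (_ : _ ^+ 2 = (r ^+ 2 * nsq w) * (s ^+ 2 * nsq w)); last by ring.
  by apply: ler_pM => //; exact: (ip_ge0 ipP).
have p0 : 0 <= r * s * nsq w by rewrite !mulr_ge0.
rewrite (le_trans (ler_norm _))// -(@ler_pXn2r _ 2)// ?nnegrE//.
by rewrite real_normK// num_real.
Qed.

(** * Square roots by a polynomial iteration *)

Section SquareRoot.
Variables (X : V -> V) (Xs : symmetric_op X).
Hypothesis X01 : forall u, 0 <= ip (X u) u <= nsq u.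

(* Polynomials in [X] with nonnegative coefficients, together with their value
   at [1], which bounds their norm. *)
Inductive nonneg_poly : (V -> V) -> R -> Prop :=
| NonnegX : nonneg_poly X 1
| Nonneg0 : nonneg_poly (fun=> 0) 0
| NonnegD A r B s : nonneg_poly A r -> nonneg_poly B s ->
    nonneg_poly (fun u => A u + B u) (r + s)
| NonnegM A r B s : nonneg_poly A r -> nonneg_poly B s ->
    nonneg_poly (fun u => A (B u)) (r * s)
| NonnegZ k A r : 0 <= k -> nonneg_poly A r ->
    nonneg_poly (fun u => k%:C *: A u) (k * r).

Lemma nonneg_poly_ge0 A r : nonneg_poly A r -> 0 <= r.
Proof.
by elim=> //= *; [exact: addr_ge0|exact: mulr_ge0|exact: mulr_ge0].
Qed.

Lemma nonneg_poly_commute Z : real_linear_on setT Z ->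
  (forall u, Z (X u) = X (Z u)) ->
  forall A r, nonneg_poly A r -> forall u, Z (A u) = A (Z u).
Proof.
move=> Zl ZX A r; elim=> //=.
- by move=> u; rewrite rl0.
- by move=> {}A {}r B s _ ZA _ ZB u; rewrite rlD// ZA ZB.
- by move=> {}A {}r B s _ ZA _ ZB u; rewrite ZA ZB.
- by move=> k {}A {}r _ _ ZA u; rewrite rlZ// ZA.
Qed.

Lemma nonneg_poly_linear A r : nonneg_poly A r -> real_linear_on setT A.
Proof.
have Xl := (symmetric_opL ipP Xs).
elim=> {A r} //=.
- by move=> r u v _ _; rewrite scaler0 addr0.
- by move=> A r B s _ Al _ Bl t u v _ _; rewrite Al// Bl// scalerDr addrACA.
- by move=> A r B s _ Al _ Bl t u v _ _; rewrite Bl// Al.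
- move=> k A r _ _ Al t u v _ _.
  by rewrite Al// scalerDr !scalerA [k%:C * _]mulrC.
Qed.

Lemma nonneg_polyC A r B s : nonneg_poly A r -> nonneg_poly B s ->
  forall u, A (B u) = B (A u).
Proof.
move=> hA hB; apply: (nonneg_poly_commute _ _ hB).
  exact: nonneg_poly_linear hA.
move=> u; apply: esym; apply: (nonneg_poly_commute _ _ hA) => //.
exact: (symmetric_opL ipP).
Qed.

Lemma nonneg_poly_symmetric A r : nonneg_poly A r -> symmetric_op A.
Proof.
elim=> {A r} //=.
- by move=> u v; rewrite ip0l// ip0r.
- by move=> A r B s _ As _ Bs u v; rewrite !ipE As Bs.
- by move=> A r B s hA As hB Bs u v; rewrite As Bs (nonneg_polyC hA hB).
- by move=> k A r _ _ As u v; rewrite !ipE As.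
Qed.

Lemma nonneg_poly_bounded A r : nonneg_poly A r ->
  forall u, nsq (A u) <= r ^+ 2 * nsq u.
Proof.
elim=> {A r} //=.
- move=> u; rewrite expr1n mul1r; have /andP[_ h] := X01 u.
  have X1 w : 0 <= ip (X w) w <= 1 * nsq w by rewrite mul1r.
  by apply: le_trans h; have := nsq_symmetric_le ipP Xs X1 u; rewrite mul1r.
- by move=> u; rewrite ip0l// expr0n mul0r.
- move=> A r B s /nonneg_poly_ge0 r0 hA /nonneg_poly_ge0 s0 hB u.
  have := ip_le_of_nsq r0 s0 (hA u) (hB u).
  have := hA u; have := hB u; rewrite !ipE (ipC ipP (B u) (A u)); nra.
- move=> A r B s /nonneg_poly_ge0 r0 hA /nonneg_poly_ge0 s0 hB u.
  by rewrite (le_trans (hA _))// exprMn -[leRHS]mulrA ler_wpM2l// sqr_ge0.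
- move=> k A r k0 _ hA u.
  by rewrite nsqZ// exprMn -[leRHS]mulrA ler_wpM2l// sqr_ge0.
Qed.

(* The iteration for [1 - sqrt (1 - X)]. *)
Fixpoint sqrt_iter n : V -> V :=
  if n is m.+1
  then fun u => (2^-1)%:C *: (X u + sqrt_iter m (sqrt_iter m u))
  else fun=> 0.

Fixpoint sqrt_bound n : R :=
  if n is m.+1 then 2^-1 * (1 + sqrt_bound m * sqrt_bound m) else 0.

Lemma sqrt_iter_poly n : nonneg_poly (sqrt_iter n) (sqrt_bound n).
Proof.
elim: n => [|n h] /=; first exact: Nonneg0.
apply: NonnegZ; first by rewrite invr_ge0.
by apply: NonnegD; [exact: NonnegX|exact: NonnegM].
Qed.

(** Since the iterates commute, the next increment is half of [(Y' + Y)(Y' - Y)], where [Y], [Y']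
    are consecutive iterates: increments again have nonnegative coefficients. Their norms are thus
    bounded by the increments of [sqrt_bound], a bounded monotone sequence, and the iteration is
    Cauchy. *)
Lemma sqrt_iter_step n : exists2 A,
  nonneg_poly A (sqrt_bound n.+1 - sqrt_bound n) &
  forall u, sqrt_iter n.+1 u - sqrt_iter n u = A u.
Proof.
elim: n => [|n [A hA AE]].
  exists (sqrt_iter 1); first by rewrite subr0; exact: sqrt_iter_poly.
  by move=> u; rewrite [sqrt_iter 0]/= subr0.
have [h0 h1] := (sqrt_iter_poly n, sqrt_iter_poly n.+1).
exists (fun u => (2^-1)%:C *: (sqrt_iter n.+1 (A u) + sqrt_iter n (A u))).
  have -> : sqrt_bound n.+2 - sqrt_bound n.+1 =
      2^-1 * (sqrt_bound n.+1 * (sqrt_bound n.+1 - sqrt_bound n) +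
              sqrt_bound n * (sqrt_bound n.+1 - sqrt_bound n)).
    by rewrite [sqrt_bound n.+2]/= -[2^-1 * (1 + sqrt_bound n * sqrt_bound n)]
       /(sqrt_bound n.+1) [X in _ - X = _]/=; ring.
  apply: NonnegZ; first by rewrite invr_ge0.
  by apply: NonnegD; exact: NonnegM.
move=> u; rewrite -AE.
rewrite !(rlB (nonneg_poly_linear h0)) !(rlB (nonneg_poly_linear h1)).
have -> : sqrt_iter n.+2 u =
  (2^-1)%:C *: (X u + sqrt_iter n.+1 (sqrt_iter n.+1 u)) by [].
have {2}-> : sqrt_iter n.+1 u =
  (2^-1)%:C *: (X u + sqrt_iter n (sqrt_iter n u)) by [].
rewrite -scalerBr (nonneg_polyC h1 h0); congr (_ *: _).
by rewrite opprD addrACA subrr add0r addrA subrK.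
Qed.

Lemma sqrt_iter_diff n k : exists2 A,
  nonneg_poly A (sqrt_bound (k + n) - sqrt_bound n) &
  forall u, sqrt_iter (k + n) u - sqrt_iter n u = A u.
Proof.
elim: k => [|k [A hA AE]].
  exists (fun=> 0); first by rewrite subrr; exact: Nonneg0.
  by move=> u; rewrite subrr.
have [B hB BE] := sqrt_iter_step (k + n).
exists (fun u => B u + A u).
  by have := NonnegD hB hA; rewrite addrA subrK.
by move=> u; rewrite -AE -BE addrA subrK.
Qed.

Lemma sqrt_bound_homo n k : (n <= k)%N -> sqrt_bound n <= sqrt_bound k.
Proof.
move=> /subnK <-; have [A hA _] := sqrt_iter_diff n (k - n).
by rewrite -subr_ge0; exact: nonneg_poly_ge0 hA.
Qed.

Lemma sqrt_bound_le1 n : sqrt_bound n <= 1.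
Proof.
elim: n => [|n h] //=; have := nonneg_poly_ge0 (sqrt_iter_poly n); nra.
Qed.

Lemma sqrt_iter_cvg : exists Y : V -> V, forall u, hconv (sqrt_iter^~ u) (Y u).
Proof.
have [L bL] : exists L : R, sqrt_bound n @[n --> \oo] --> L.
  exists (limn sqrt_bound); apply: nondecreasing_is_cvgn.
    by move=> n k; exact: sqrt_bound_homo.
  by exists 1 => _ [n _ <-]; exact: sqrt_bound_le1.
have bleL n : sqrt_bound n <= L.
  apply: (cvgr_to_ge bL); near=> k; apply: sqrt_bound_homo.
  by near: k; exact: nbhs_infty_ge.
have /choice[Y YP] u : exists l, hconv (sqrt_iter^~ u) l; last by exists Y.
have h : (L - sqrt_bound n) * (L - sqrt_bound n) * nsq u @[n --> \oo] -->
    (0 : R).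
  have -> : 0 = (L - L) * (L - L) * nsq u by rewrite subrr !mul0r.
  apply: cvgM; last exact: cvg_cst.
  by apply: cvgM; apply: cvgB => //; exact: cvg_cst.
apply: (hconv_of_cauchy (u := sqrt_iter^~ u) ipP _ h) => n k nk.
have [A hA AE] := sqrt_iter_diff n (k - n); rewrite subnK// in hA AE.
rewrite -(nsqN ipP) opprB AE (le_trans (nonneg_poly_bounded hA _))//.
rewrite ler_wpM2r ?(ip_ge0 ipP)// -expr2 ler_pXn2r// ?nnegrE ?subr_ge0//.
  by rewrite lerD2r.
exact: sqrt_bound_homo.
Unshelve. all: by end_near. Qed.

(** The limit satisfies [Y = (X + Y^2) / 2], that is, [(1 - Y)^2 = 1 - X]. Whatever is bounded and
    commutes with [X] commutes with all iterates, hence with [Y]. *)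
Lemma sqrt_1subX : exists S : V -> V, [/\ symmetric_op S,
  forall u, 0 <= ip (S u) u, forall u, S (S u) = u - X u &
  forall Z C, real_linear_on setT Z -> (forall u, nsq (Z u) <= C * nsq u) ->
    (forall u, Z (X u) = X (Z u)) -> forall u, Z (S u) = S (Z u)].
Proof.
have [Y YP] := sqrt_iter_cvg.
have Ys : symmetric_op Y.
  move=> u v; rewrite (ipC ipP u).
  suff h : ip (sqrt_iter n u) v @[n --> \oo] --> ip (Y v) u.
    exact: cvg_unique (hconv_ip ipP (w := v) (YP u)) h.
  apply: eq_cvgn (hconv_ip ipP (w := u) (YP v)) => n.
  by rewrite (ipC ipP) (nonneg_poly_symmetric (sqrt_iter_poly n)).
have Yl := (symmetric_opL ipP Ys).
have iter_le n u : nsq (sqrt_iter n u) <= nsq u.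
  rewrite (le_trans (nonneg_poly_bounded (sqrt_iter_poly n) u))//.
  rewrite ler_piMl ?(ip_ge0 ipP)// exprn_ile1 ?sqrt_bound_le1//.
  exact: nonneg_poly_ge0 (sqrt_iter_poly n).
have Y_le u : nsq (Y u) <= nsq u.
  apply: (cvgn_le (a := fun n => nsq (sqrt_iter n u)) (b := fun=> nsq u)) => //.
    exact: (hconv_nsq ipP (YP u)).
  exact: cvg_cst.
have YE u : Y u = (2^-1)%:C *: (X u + Y (Y u)).
  apply: (hconv_unique ipP (u := fun n => sqrt_iter n.+1 u)).
    have : nsq (sqrt_iter n u - Y u) @[n --> \oo] --> (0 : R) by exact: YP.
    by rewrite -(cvg_shiftS (fun n => nsq (sqrt_iter n u - Y u))).
  apply: (hconvZ ipP); apply: (hconvD ipP); first exact: (hconv_cst ipP).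
  have h : 2 * nsq (sqrt_iter n u - Y u) + 2 * nsq (sqrt_iter n (Y u) - Y (Y u))
      @[n --> \oo] --> (0 : R).
    have -> : (0 : R) = 2 * 0 + 2 * 0 by rewrite mulr0 addr0.
    by apply: cvgD; apply: cvgM => //; (exact: cvg_cst || exact: YP).
  apply: (hconv_le ipP (C := 1) _ h) => n; rewrite mul1r.
  have -> : sqrt_iter n (sqrt_iter n u) - Y (Y u) =
      sqrt_iter n (sqrt_iter n u - Y u) + (sqrt_iter n (Y u) - Y (Y u)).
    by rewrite (rlB (nonneg_poly_linear (sqrt_iter_poly n))) addrA subrK.
  by rewrite (le_trans (nsqD_le ipP _ _))// lerD2r ler_pM2l.
exists (fun u => u - Y u); split.
- by move=> u v; rewrite !ipE Ys.
- move=> u; rewrite !ipE subr_ge0.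
  have := @ip_le_of_nsq 1 1 (Y u) u u ler01 ler01.
  by rewrite expr1n !mul1r; apply.
- move=> u; rewrite rlB//.
  have yy : Y u + Y u = X u + Y (Y u).
    rewrite {1 2}YE -scalerDl -rmorphD /=.
    have -> : 2^-1 + 2^-1 = 1 :> R by field.
    by rewrite scale1r.
  have -> : X u = Y u + Y u - Y (Y u) by rewrite yy addrK.
  by rewrite -addrA; congr (u + _); rewrite !opprB opprD addrCA.
- move=> Z C Zl ZC ZX u; rewrite rlB//; congr (_ - _).
  apply: (hconv_unique ipP (u := fun n => Z (sqrt_iter n u))).
    by apply: (hconv_map ipP _ ZC (YP u)); exact: rlB.
  have -> : (fun n => Z (sqrt_iter n u)) = sqrt_iter^~ (Z u).
    apply/funext => n; exact: (nonneg_poly_commute Zl ZX (sqrt_iter_poly n)).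
  exact: YP.
Qed.

End SquareRoot.

Lemma symmetric_sqrt T C : symmetric_op T -> 0 < C ->
  (forall u, 0 <= ip (T u) u <= C * nsq u) ->
  exists S : V -> V, [/\ symmetric_op S,
  forall u, 0 <= ip (S u) u, forall u, S (S u) = T u &
  forall Z K, real_linear_on setT Z -> (forall u, nsq (Z u) <= K * nsq u) ->
    (forall u, Z (T u) = T (Z u)) -> forall u, Z (S u) = S (Z u)].
Proof.
move=> Ts C0 T0C; pose X u := u - (C^-1)%:C *: T u.
have [||S [Ss S0 SX SZ]] := @sqrt_1subX X.
- by move=> u v; rewrite !ipE Ts.
- move=> u; have /andP[h1 h2] := T0C u; rewrite !ipE.
  rewrite subr_ge0 gerBl ler_pdivrMl// h2 /=.
  by rewrite mulr_ge0// invr_ge0 ltW.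
pose c := Num.sqrt C; have c2 : c * c = C by rewrite -expr2 sqr_sqrtr// ltW.
exists (fun u => c%:C *: S u); split.
- by move=> u v; rewrite !ipE Ss.
- by move=> u; rewrite !ipE mulr_ge0// sqrtr_ge0.
- move=> u; rewrite (rlZ (symmetric_opL ipP Ss)) scalerA -rmorphM /= c2 SX /X.
  rewrite opprB addrC subrK scalerA -rmorphM /= divff ?gt_eqF// scale1r//.
- move=> Z K Zl ZK ZT u; rewrite rlZ//; congr (_ *: _).
  by apply: (SZ Z K) => // v; rewrite /X rlB// rlZ// ZT.
Qed.

End Theory.

(** * Operators and von Neumann algebras *)

Section Operators.
Variables (R : realType) (H : hilbertType R).
Implicit Types (u v w : H) (a b x y : H -> H) (M D : set (H -> H)) (r s : R).

Local Notation Re := complex.Re.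
Local Notation Im := complex.Im.
Local Notation ii := (Complex (0 : R) 1).

Lemma hdotL (k : R[i]) u v w : hdot (k *: u + v) w = k * hdot u w + hdot v w.
Proof. by rewrite linearDl linearZl_LR. Qed.

Lemma hdotDl u v w : hdot (u + v) w = hdot u w + hdot v w.
Proof. exact: linearDl. Qed.

Lemma hdotZl (k : R[i]) u w : hdot (k *: u) w = k * hdot u w.
Proof. exact: linearZl_LR. Qed.

Lemma hdotC u v : hdot u v = conjc (hdot v u).
Proof. by rewrite (hermC hdot) expr0 mul1r. Qed.

Lemma hdotDr u v w : hdot w (u + v) = hdot w u + hdot w v.
Proof. by rewrite hdotC hdotDl rmorphD /= -!hdotC. Qed.

Lemma hdotZr (k : R[i]) u w : hdot w (k *: u) = conjc k * hdot w u.
Proof. by rewrite hdotC hdotZl rmorphM /= -hdotC. Qed.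

Definition rip u v : R := Re (hdot u v).
Local Notation nsq u := (rip u u).

Lemma hdot_self u : hdot u u = (nsq u)%:C.
Proof.
have := dnorm_ge0 hdot u; rewrite /rip.
by case: (hdot u u) => c d; rewrite lecE /= => /andP[/eqP-> _].
Qed.

Lemma sqr_norm_nsq u : `|u| ^+ 2 = (nsq u)%:C :> R[i].
Proof. by rewrite hdot_norm hdot_self. Qed.

Lemma ltc_norm u r : 0 < r -> (`|u| < r%:C) = (nsq u < r ^+ 2).
Proof.
move=> r0; rewrite -(@ltr_pXn2r _ 2)// ?nnegrE ?normr_ge0 ?ler0c ?(ltW r0)//.
by rewrite sqr_norm_nsq -rmorphXn ltcR.
Qed.

Lemma pos_complex (e : R[i]) : 0 < e -> exists2 r, 0 < r & e = r%:C.
Proof.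
case: e => r s; rewrite ltcE /= => /andP[/eqP-> r0]; by exists r.
Qed.

Lemma hilbert_rip : hilbert rip.
Proof.
split.
- by move=> u v; rewrite /rip hdotC; case: (hdot _ _).
- by move=> r u v w; rewrite /rip hdotL; case: (hdot _ _) => p q; case: (hdot _ _) => p' q';
     rewrite /= mul0r subr0.
- by move=> u; rewrite -ler0c -hdot_self; exact: dnorm_ge0.
- by move=> u u0; apply/eqP; rewrite -(dnorm_eq0 hdot) hdot_self u0.
- move=> u uC.
  have : cvg (u @ \oo).
    apply: cauchy_cvg; apply: cauchy_exP => e /pos_complex[r r0 ->].
    have [|N hN] := uC (r ^+ 2); first by rewrite exprn_gt0.
    exists (u N); exists N => // n /= Nn.
    by rewrite -ball_normE /= ltc_norm// hN.
  move=> ul; exists (lim (u @ \oo)).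
  apply/cvgr0Pnorm_lt => e e0.
  have se0 : 0 < Num.sqrt e by rewrite sqrtr_gt0.
  have /cvgrPdist_lt/(_ (Num.sqrt e)%:C) := ul.
  rewrite ltcR => /(_ se0); apply: filterS => n.
  rewrite distrC ltc_norm// sqr_sqrtr ?(ltW e0)// => h.
  by rewrite ger0_norm// -ler0c -hdot_self; exact: dnorm_ge0.
Qed.

Lemma rip_ii u v : rip (ii *: u) v = - rip u (ii *: v).
Proof.
rewrite /rip hdotZl hdotZr; case: (hdot _ _) => p q /=.
ring.
Qed.

Lemma hdotE u v : hdot u v = Complex (rip u v) (rip u (ii *: v)).
Proof.
rewrite /rip hdotZr; case: (hdot _ _) => p q /=.
congr Complex; ring.
Qed.

Lemma bounded_op_linear a : bounded_op a -> linear a.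
Proof. by case. Qed.

Lemma linear_real_linear (V W : lmodType R[i]) (f : V -> W) :
  linear f -> real_linear_on setT f.
Proof. by move=> fl r u v _ _; exact: fl. Qed.

Lemma bounded_op_bound a : bounded_op a ->
  exists2 C, 0 < C & forall u, nsq (a u) <= C * nsq u.
Proof.
case=> al ac; have al' := linear_real_linear al.
have a0 : a 0 = 0 by exact: rl0.
have /cvgrPdist_lt/(_ 1 ltr01) := ac 0.
rewrite a0 => /nbhs_ballP[e /pos_complex[r r0 ->] he].
have hr u : nsq u < r ^+ 2 -> nsq (a u) < 1.
  move=> ur; have := he u; rewrite -ball_normE /= !sub0r !normrN.
  rewrite ltc_norm// => /(_ ur).
  have -> : (1 : R[i]) = (1 : R)%:C by [].
  by rewrite ltc_norm// expr1n.
exists (2 / r ^+ 2); first by rewrite divr_gt0// exprn_gt0.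
move=> u; have := ip_ge0 hilbert_rip u; rewrite le_eqVlt => /orP[/eqP u0|u0].
  rewrite (ip_eq0 hilbert_rip (esym u0)) a0 (ip0l hilbert_rip) mulr0//.
(* [t] scales [u] to squared norm [r ^+ 2 / 2], strictly inside the ball; hence the constant
   [2 / r ^+ 2]. *)
pose t := r / Num.sqrt (2 * nsq u).
have t2 : t ^+ 2 = r ^+ 2 / (2 * nsq u).
  by rewrite expr_div_n sqr_sqrtr// mulr_ge0// ltW.
have : nsq (t%:C *: u) < r ^+ 2.
  rewrite (nsqZ hilbert_rip) t2 -mulrA; have r2 : 0 < r ^+ 2 by rewrite exprn_gt0.
  rewrite gtr_pMr// invfM mulrAC -mulrA divff ?gt_eqF// mulr1.
  by rewrite invf_lt1 ?ltr1n.
move=> /hr; rewrite (rlZ al') (nsqZ hilbert_rip) t2.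
rewrite mulrAC ltr_pdivrMr ?mulr_gt0// mul1r => /ltW h.
by rewrite mulrAC ler_pdivlMr ?exprn_gt0// mulrC.
Qed.

Lemma bounded_opI a C : linear a -> (forall u, nsq (a u) <= C * nsq u) ->
  bounded_op a.
Proof.
move=> al aC; split=> // u; apply/cvgrPdist_lt => e /pos_complex[r r0 ->].
have C1 : 0 < `|C| + 1 by rewrite ltr_wpDl.
pose d := Num.sqrt (r ^+ 2 / (`|C| + 1)).
have d0 : 0 < d by rewrite sqrtr_gt0 divr_gt0// exprn_gt0.
near=> v.
rewrite -(rlB (linear_real_linear al)) ltc_norm//.
have : `|u - v| < d%:C by near: v; apply: cvgr_dist_lt => //; rewrite ltcR.
rewrite ltc_norm// sqr_sqrtr; last by rewrite divr_ge0 ?ltW// exprn_gt0.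
rewrite ltr_pdivlMr//; apply: le_lt_trans.
rewrite (le_trans (aC _))// mulrC ler_wpM2l ?(ip_ge0 hilbert_rip)//.
by rewrite (le_trans (ler_norm C))// lerDl.
Unshelve. all: by end_near. Qed.

Lemma rip_inj u v : (forall w, rip u w = rip v w) -> u = v.
Proof. exact: (ip_inj hilbert_rip). Qed.

Lemma rip_iir u v : rip u (ii *: v) = - rip (ii *: u) v.
Proof. by rewrite rip_ii opprK. Qed.

Lemma linear0 (V W : lmodType R[i]) (f : V -> W) : linear f -> f 0 = 0.
Proof. by move/linear_real_linear/rl0. Qed.

Lemma linearZ_op (V W : lmodType R[i]) (f : V -> W) (k : R[i]) (u : V) :
  linear f -> f (k *: u) = k *: f u.
Proof. by move=> fl; have := fl k u 0; rewrite !addr0 (linear0 fl) addr0. Qed.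

Lemma is_adjointI a b : linear a -> (forall u v, rip (a u) v = rip u (b v)) ->
  is_adjoint a b.
Proof.
move=> al h u v; rewrite !hdotE h; congr Complex.
by rewrite !rip_iir -(linearZ_op _ _ al) h.
Qed.

Lemma is_adjoint_rip a b u v : is_adjoint a b -> rip (a u) v = rip u (b v).
Proof. by rewrite /rip => ->. Qed.

Lemma is_adjoint_sym a b : is_adjoint a b -> is_adjoint b a.
Proof. by move=> h u v; rewrite hdotC -h -hdotC. Qed.

Lemma is_adjoint_unique a b c : is_adjoint a b -> is_adjoint a c -> b = c.
Proof.
move=> hb hc; apply/funext => v; apply: rip_inj => w.
by rewrite !(ipC hilbert_rip _ w) -(is_adjoint_rip _ _ hb) (is_adjoint_rip _ _ hc).
Qed.

Lemma is_adjoint_linear a b : is_adjoint a b -> linear b.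
Proof.
move=> h k u v; apply: rip_inj => w; rewrite /rip; congr Re.
by rewrite hdotL hdotC -h hdotDr hdotZr rmorphD rmorphM /= conjcK !h -!hdotC.
Qed.

Lemma is_adjoint_bound a b C : is_adjoint a b -> 0 < C ->
  (forall u, nsq (a u) <= C * nsq u) -> forall u, nsq (b u) <= C * nsq u.
Proof.
move=> h C0 aC u; have := cauchy_schwarz hilbert_rip (a (b u)) u.
rewrite (is_adjoint_rip _ _ h) => cs.
have := ip_ge0 hilbert_rip (b u); rewrite le_eqVlt => /orP[/eqP<-|b0].
  by rewrite mulr_ge0 ?(ip_ge0 hilbert_rip)// ltW.
rewrite -(ler_pM2l b0) -expr2 (le_trans cs)// mulrCA mulrA.
by rewrite ler_wpM2r ?(ip_ge0 hilbert_rip).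
Qed.

Lemma adjoint_exists a : bounded_op a ->
  exists2 b, bounded_op b & is_adjoint a b.
Proof.
move=> ab; have al := bounded_op_linear ab.
have [C C0 aC] := bounded_op_bound ab.
have /choice[b bP] v : exists l, forall u, rip u l = rip (a u) v.
  have [|||||l [_ hl]] := @riesz _ _ _ hilbert_rip H setT id
    (fun u => rip (a u) v) (C * nsq v).
  - by [].
  - by [].
  - by move=> r u w _ _; rewrite al !(ipE hilbert_rip).
  - by rewrite mulr_ge0 ?(ip_ge0 hilbert_rip)// ltW.
  - move=> u _; rewrite (le_trans (cauchy_schwarz hilbert_rip _ _))//.
    by rewrite mulrAC ler_wpM2r// (ip_ge0 hilbert_rip).
  by exists l => u; exact: hl.
have h : is_adjoint a b by apply: is_adjointI.
exists b => //; apply: (@bounded_opI _ C); first exact: is_adjoint_linear h.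
exact: is_adjoint_bound h C0 aC.
Qed.

Local Notation symmetric_op := (symmetric_op rip).

(** Over complex scalars positivity forces symmetry: the imaginary part of [<a u, u>] is
    [rip (a u) (ii *: u)], and polarising its vanishing at [u] and [ii *: v] gives the claim. *)
Lemma positive_opP a : linear a ->
  positive_op a <-> symmetric_op a /\ forall u, 0 <= rip (a u) u.
Proof.
move=> al; split=> [a0|[asym a0] u]; last first.
  rewrite hdotE lecE /= a0 andbT; apply/eqP.
  have := rip_iir (a u) u; rewrite -(linearZ_op _ _ al).
  by rewrite (asym (ii *: u)) (ipC hilbert_rip (ii *: u)); lra.
have im0 u : rip (a u) (ii *: u) = 0.
  by have := a0 u; rewrite hdotE lecE /= => /andP[/eqP].
split=> [u v|u]; last by have := a0 u; rewrite hdotE lecE => /andP[].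
have al' := linear_real_linear al.
have key w z : rip (a w) (ii *: z) + rip (a z) (ii *: w) = 0.
  have := im0 (w + z); rewrite (rlD al') scalerDr !(ipE hilbert_rip) !im0.
  by rewrite add0r addr0.
have := key u (ii *: v); rewrite (linearZ_op _ _ al) rip_ii !scalerA.
have -> : ii * ii = -1 :> R[i] by rewrite -expr2 sqr_i.
by rewrite !scaleN1r !(ipNr hilbert_rip) (ipC hilbert_rip u); lra.
Qed.

Lemma symmetric_adjoint a : linear a -> symmetric_op a <-> is_adjoint a a.
Proof.
by move=> al; split=> [h|h u v]; [exact: is_adjointI|exact: is_adjoint_rip h].
Qed.

Lemma symmetric_linear a : symmetric_op a -> (forall u, a (ii *: u) = ii *: a u) ->
  linear a.
Proof.
move=> asym aii [p q] u v; have al := symmetric_opL hilbert_rip asym.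
have kE w : Complex p q *: w = p%:C *: w + ii *: (q%:C *: w) :> H.
  by rewrite scalerA -scalerDl {1}[Complex p q]complexE.
by rewrite !kE !(rlD al) aii !(rlZ al).
Qed.

Lemma nsq_complexZ (k : R[i]) u : nsq (k *: u) = (Re k ^+ 2 + Im k ^+ 2) * nsq u.
Proof.
by apply: complexI; rewrite -!hdot_self dnormZ -add_Re2_Im2 hdot_self -rmorphM.
Qed.

Section VonNeumann.
Variables (A : set (H -> H)) (Avn : von_neumann_algebra A).

Lemma vn_bounded a : A a -> bounded_op a.
Proof. by case: Avn => h _ _; exact: h. Qed.

Lemma vn_linear a : A a -> linear a.
Proof. by move/vn_bounded/bounded_op_linear. Qed.

Lemma vn_adjoint a : A a -> exists2 b, A b & is_adjoint a b.
Proof. by case: Avn => _ h _; exact: h. Qed.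

Lemma vn_commute t a u : commutant A t -> A a -> a (t u) = t (a u).
Proof. by move=> [_ h] /h /(congr1 (@^~ u)). Qed.

(** The bicommutant clause as a membership test, through which the closure properties of [A] are
    proved. *)
Lemma vn_mem a : bounded_op a ->
  (forall t u, commutant A t -> a (t u) = t (a u)) -> A a.
Proof.
move=> ab h; case: Avn => _ _ AE; rewrite -AE; split=> // t At; apply/funext => u /=.
by rewrite h.
Qed.

Lemma commutant_bounded t : commutant A t -> bounded_op t.
Proof. by case. Qed.

Lemma commutantI t : bounded_op t -> (forall a u, A a -> a (t u) = t (a u)) ->
  commutant A t.
Proof. by move=> tb h; split=> // a Aa; apply/funext => u; exact: h. Qed.

Lemma bounded_opL (k : R[i]) a b :
  bounded_op a -> bounded_op b -> bounded_op (k *: a + b).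
Proof.
move=> ab bb; have [C C0 aC] := bounded_op_bound ab.
have [K K0 bK] := bounded_op_bound bb.
have [al bl] := (bounded_op_linear ab, bounded_op_linear bb).
apply: (@bounded_opI _ (2 * ((Re k ^+ 2 + Im k ^+ 2) * C) + 2 * K)).
  move=> c u v; rewrite !fctE /= al bl !scalerDr !scalerA [k * c]mulrC.
  by rewrite addrACA.
move=> u; rewrite !fctE /= (le_trans (nsqD_le hilbert_rip _ _))// nsq_complexZ [leRHS]mulrDl.
have := aC u; have := bK u => h1 h2.
apply: lerD; rewrite -!mulrA ler_pM2l//.
by rewrite ler_wpM2l// addr_ge0// sqr_ge0.
Qed.

Lemma vn_lin (k : R[i]) a b : A a -> A b -> A (k *: a + b).
Proof.
move=> Aa Ab; apply: vn_mem; first by apply: bounded_opL; exact: vn_bounded.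
move=> t u At; have tl := bounded_op_linear (commutant_bounded At).
by rewrite !fctE /= !(vn_commute u At)// tl.
Qed.

Lemma bounded_op_comp a b : bounded_op a -> bounded_op b -> bounded_op (a \o b).
Proof.
move=> ab bb; have [C C0 aC] := bounded_op_bound ab.
have [K K0 bK] := bounded_op_bound bb.
have [al bl] := (bounded_op_linear ab, bounded_op_linear bb).
apply: (@bounded_opI _ (C * K)); first by move=> c u v /=; rewrite bl al.
by move=> u /=; rewrite (le_trans (aC _))// -mulrA ler_pM2l.
Qed.

Lemma vn_comp a b : A a -> A b -> A (a \o b).
Proof.
move=> Aa Ab; apply: vn_mem; first by apply: bounded_op_comp; exact: vn_bounded.
by move=> t u At /=; rewrite !(vn_commute _ At).
Qed.

Lemma vn_id : A idfun.
Proof.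
by apply: vn_mem => //; apply: (@bounded_opI _ 1) => // u; rewrite mul1r.
Qed.

Lemma vn_0 : A 0.
Proof.
apply: vn_mem => [|t u At]; last first.
  by rewrite (linear0 (bounded_op_linear (commutant_bounded At))).
apply: (@bounded_opI _ 1) => [k u v|u].
  by change (0 = k *: 0 + 0 :> H); rewrite scaler0 addr0.
change (rip 0 0 <= 1 * nsq u).
by rewrite (ip0l hilbert_rip) mul1r (ip_ge0 hilbert_rip).
Qed.

Lemma vnZ (k : R[i]) a : A a -> A (k *: a).
Proof. by move=> Aa; have := vn_lin k Aa vn_0; rewrite addr0. Qed.

Lemma vnD a b : A a -> A b -> A (a + b).
Proof. by move=> Aa Ab; have := vn_lin 1 Aa Ab; rewrite scale1r. Qed.

Lemma vnN a : A a -> A (- a).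
Proof. by move=> Aa; rewrite -scaleN1r; exact: vnZ. Qed.

Lemma vnB a b : A a -> A b -> A (a - b).
Proof. by move=> Aa Ab; apply: vnD => //; exact: vnN. Qed.

Lemma commutant_adjoint t t' : commutant A t -> is_adjoint t t' ->
  bounded_op t' -> commutant A t'.
Proof.
move=> At h bt'; apply: commutantI => // a u Aa.
have [b Ab ab] := vn_adjoint Aa.
apply: rip_inj => w; rewrite (is_adjoint_rip _ _ ab).
rewrite (is_adjoint_rip _ _ (is_adjoint_sym h)).
rewrite (is_adjoint_rip _ _ (is_adjoint_sym h)) (is_adjoint_rip _ _ ab).
by rewrite (vn_commute _ At).
Qed.

(** Multiplication by [ii] is treated as one more element of the commutant. A symmetric operator, so
    far only real linear, that commutes with the commutant is thereby complex linear. *)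
Lemma commutant_ii : commutant A (fun u => ii *: u).
Proof.
apply: commutantI => [|a u Aa]; last exact: linearZ_op (vn_linear Aa).
apply: (@bounded_opI _ 1) => [k u v|u].
  by rewrite scalerDr !scalerA mulrC.
by rewrite rip_ii scalerA -expr2 sqr_i scaleN1r (ipNr hilbert_rip) opprK mul1r.
Qed.

Lemma vn_symmetric_mem a C : symmetric_op a -> (forall u, nsq (a u) <= C * nsq u) ->
  (forall t u, commutant A t -> a (t u) = t (a u)) -> A a.
Proof.
move=> asym aC h; apply: vn_mem => //; apply: bounded_opI aC.
by apply: symmetric_linear => // u; exact: h commutant_ii.
Qed.

Lemma vn_symmetric_sqrt a : A a -> symmetric_op a -> (forall u, 0 <= rip (a u) u) ->
  exists2 s, A s /\ symmetric_op s & (forall u, 0 <= rip (s u) u) /\ s \o s = a /\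
    forall b, A b -> b \o a = a \o b -> b \o s = s \o b.
Proof.
move=> Aa asym a0; have [C C0 aC] := bounded_op_bound (vn_bounded Aa).
(* The constant comes from [0 <= nsq (a u - u)], which bounds [2 * rip (a u) u] by
   [nsq (a u) + nsq u]. *)
have aC1 u : 0 <= rip (a u) u <= (C + 1) * nsq u.
  rewrite a0 /=; have := aC u; have := ip_ge0 hilbert_rip (a u - u).
  rewrite !(ipE hilbert_rip) (ipC hilbert_rip u (a u)).
  have := ip_ge0 hilbert_rip u; have := a0 u; nra.
have C1 : 0 < C + 1 by rewrite addr_gt0.
have [s [ssym s0 ss sZ]] := symmetric_sqrt hilbert_rip asym C1 aC1.
have sb u : nsq (s u) <= (C + 1) * nsq u.
  by rewrite -ssym ss; case/andP: (aC1 u).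
exists s; split=> //.
  apply: (vn_symmetric_mem ssym sb) => t u At.
  have [K _ tK] := bounded_op_bound (commutant_bounded At).
  apply: esym; apply: (sZ t K) => //.
    exact: linear_real_linear (bounded_op_linear (commutant_bounded At)).
  by move=> v; rewrite (vn_commute v At Aa).
split; first by apply/funext => u; exact: ss.
move=> b Ab ba; have [K _ bK] := bounded_op_bound (vn_bounded Ab).
apply/funext => u; apply: (sZ b K) => //.
  exact: linear_real_linear (vn_linear Ab).
by move=> v; exact: (congr1 (@^~ v) ba).
Qed.

End VonNeumann.

End Operators.

Section Operators.
Variables (R : realType) (H : hilbertType R).
Implicit Types (u v w : H) (a b x y : H -> H) (A M D : set (H -> H)) (r s : R).

Local Notation Re := complex.Re.
Local Notation Im := complex.Im.
Local Notation ii := (Complex (0 : R) 1).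
Local Notation nsq u := (rip u u).
Local Notation symmetric_on := @symmetric_op.
Local Notation symmetric_op := (symmetric_op (@rip R H)).
Local Notation hilbert_rip := (@hilbert_rip R H).

(** * Positive and negative parts of self-adjoint elements *)

Section PositiveParts.
Variables (p m s : H -> H) (C : R).
Hypotheses (psym : symmetric_op p) (pC : forall u, nsq (p u) <= C * nsq u).
Hypothesis mp0 : forall u, m (p u) = 0.

(** By [symmetric_range_le] it suffices to test on the range of [p], where [m] vanishes and [p]
    coincides with [s = p + m]. The upper bound below works in the same way with [c = p - m]. *)
Lemma positive_part_ge0 : (forall u, s u = p u + m u) ->
  (forall u, 0 <= rip (s u) u) -> forall u, 0 <= rip (p u) u.
Proof.
move=> sE s0 u; have pl := symmetric_opL hilbert_rip psym.
have h := symmetric_range_le hilbert_rip (T := fun v => - p v) (C := C) (k := 0).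
have := h _ _ (lexx 0) _ u; rewrite mul0r (ipNl hilbert_rip) oppr_le0; apply.
- by move=> v w; rewrite !(ipE hilbert_rip) psym.
- by move=> v; rewrite (nsqN hilbert_rip).
- move=> v; rewrite mul0r (rlN pl) opprK (ipNr hilbert_rip) oppr_le0.
  by have := s0 (p v); rewrite sE mp0 addr0.
Qed.

Lemma positive_part_le1 c : (forall u, c u = p u - m u) ->
  (forall u, rip (c u) u <= nsq u) -> forall u, rip (p u) u <= nsq u.
Proof.
move=> cE c1 u; have h := symmetric_range_le hilbert_rip psym pC ler01 _ u.
rewrite mul1r in h; apply: h => v.
by rewrite mul1r; have := c1 (p v); rewrite cE mp0 subr0.
Qed.

End PositiveParts.

(** Positivity as seen by [rip]. Symmetry has to be demanded: multiplication by [ii] has a vanishing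
    real quadratic form. *)
Definition psd_op a := symmetric_op a /\ forall u, 0 <= rip (a u) u.

(** With [s] the square root of [a^2], the parts are [(s + a) / 2] and [(s - a) / 2]. Their products
    vanish because [s] commutes with [a] and [s^2 = a^2]. *)
Lemma vn_pos_neg A a : von_neumann_algebra A -> A a -> symmetric_op a ->
  exists p m, [/\ A p /\ psd_op p, A m /\ psd_op m, forall u, a u = p u - m u,
    forall u, p (m u) = 0 & forall u, m (p u) = 0].
Proof.
move=> Avn Aa asym; have al := vn_linear Avn Aa.
have al' := linear_real_linear al.
have Aaa := vn_comp Avn Aa Aa.
have [||s [As ssym] [s0 [ss sC]]] := vn_symmetric_sqrt Avn Aaa.
- by move=> u v /=; rewrite !asym.
- by move=> u /=; rewrite asym; exact: (ip_ge0 hilbert_rip).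
have sa u : s (a u) = a (s u).
  by have /(congr1 (@^~ u)) := sC _ Aa (erefl _).
have {}ss u : s (s u) = a (a u) by have := congr1 (@^~ u) ss.
have sl' := linear_real_linear (vn_linear Avn As).
pose h : R[i] := (2^-1)%:C.
pose p := h *: (s + a); pose m := h *: (s - a).
have Ap : A p by apply: vnZ => //; exact: vnD.
have Am : A m by apply: vnZ => //; exact: vnB.
have pE u : p u = h *: (s u + a u) by [].
have mE u : m u = h *: (s u - a u) by [].
have psym : symmetric_op p.
  by move=> u v; rewrite !pE !(ipE hilbert_rip) asym ssym.
have msym : symmetric_op m.
  by move=> u v; rewrite !mE !(ipE hilbert_rip) asym ssym.
have pm u : p (m u) = 0.
  rewrite pE mE !(rlZ sl') !(rlZ al') !(rlB sl') !(rlB al') ss sa -scalerDr.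
  by rewrite -(opprB (a (a u)) (a (s u))) subrr !scaler0.
have mp u : m (p u) = 0.
  rewrite mE pE !(rlZ sl') !(rlZ al') !(rlD sl') !(rlD al') ss sa -scalerBr.
  by rewrite [X in _ - X]addrC subrr !scaler0.
have hh (v : H) : h *: v + h *: v = v.
  rewrite -scalerDl -rmorphD /=.
  have -> : 2^-1 + 2^-1 = 1 :> R by field.
  by rewrite scale1r.
have sE u : s u = p u + m u.
  by rewrite pE mE -scalerDr addrACA subrr addr0 scalerDr hh.
have aE u : a u = p u - m u.
  by rewrite pE mE -scalerBr opprB addrC addrA subrK scalerDr hh.
have [C _ pC] := bounded_op_bound (vn_bounded Avn Ap).
have [K _ mK] := bounded_op_bound (vn_bounded Avn Am).
exists p, m; split=> //; split=> //; split=> //.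
  exact: (positive_part_ge0 psym pC mp sE s0).
by apply: (positive_part_ge0 msym mK pm) s0 => u; rewrite addrC sE.
Qed.

(** * Square-summable sequences *)

Definition l2_summable (xi : nat -> H) :=
  exists C : R, forall n, \sum_(0 <= k < n) nsq (xi k) <= C.

Definition l2pred : {pred (nat -> H)} := fun xi => `[< l2_summable xi >].

Lemma l2_summableL (k : R[i]) xi eta :
  l2_summable xi -> l2_summable eta -> l2_summable (k *: xi + eta).
Proof.
move=> [C hC] [K hK]; pose c := Re k ^+ 2 + Im k ^+ 2.
have c0 : 0 <= c by rewrite addr_ge0// sqr_ge0.
exists (2 * (c * C) + 2 * K) => n.
apply: (@le_trans _ _ (\sum_(0 <= i < n) (2 * (c * nsq (xi i)) + 2 * nsq (eta i)))).
  apply: ler_sum => i _; rewrite !fctE.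
  by rewrite (le_trans (nsqD_le hilbert_rip _ _))// nsq_complexZ.
rewrite big_split /= -!mulr_sumr; apply: lerD; rewrite ler_pM2l//.
by apply: ler_wpM2l => //; exact: hC.
Qed.

Fact l2_submod_closed : submod_closed l2pred.
Proof.
split; first by apply/asboolP; exists 0 => n; rewrite big1// => i _; exact: (ip0l hilbert_rip).
by move=> k xi eta /asboolP hx /asboolP he; apply/asboolP/l2_summableL.
Qed.

HB.instance Definition _ :=
  GRing.isSubmodClosed.Build R[i] (nat -> H) l2pred l2_submod_closed.

(** A separate type, so that the abstract Hilbert space results apply to it. A sum of countably many
    vector functionals on [H] is one vector functional here. *)
Record ell2 := Ell2 {l2val :> nat -> H; l2valP : l2val \in l2pred}.
HB.instance Definition _ := [isSub for l2val].
HB.instance Definition _ := [Choice of ell2 by <:].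
HB.instance Definition _ := [SubChoice_isSubLmodule of ell2 by <:].

Lemma l2valD (xi eta : ell2) n : (xi + eta) n = xi n + eta n.
Proof. by []. Qed.

Lemma l2valZ (k : R[i]) (xi : ell2) n : (k *: xi) n = k *: xi n.
Proof. by []. Qed.

Lemma l2valB (xi eta : ell2) n : (xi - eta) n = xi n - eta n.
Proof. by []. Qed.

Lemma l2val_summable (xi : ell2) : l2_summable xi.
Proof. by have /asboolP := l2valP xi. Qed.

Definition to_ell2 (xi : nat -> H) : ell2 := insubd 0 xi.

Lemma to_ell2E (xi : nat -> H) : l2_summable xi -> to_ell2 xi = xi :> (nat -> H).
Proof. by move=> h; rewrite /to_ell2 -[l2val _]/(val _) insubdK//; exact/asboolP. Qed.

Lemma ell2_inj (xi eta : ell2) : (forall n, xi n = eta n) -> xi = eta.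
Proof. by move=> h; apply: val_inj; apply/funext. Qed.

Lemma rip_normr_le u v : `|rip u v| <= nsq u + nsq v.
Proof.
have := ip_ge0 hilbert_rip (u + v); have := ip_ge0 hilbert_rip (u - v).
have := ip_ge0 hilbert_rip u; have := ip_ge0 hilbert_rip v.
rewrite !(ipE hilbert_rip) (ipC hilbert_rip v u) ler_norml => *.
by apply/andP; split; lra.
Qed.

Lemma bounded_series_cvg (f : nat -> R) C : (forall n, 0 <= f n) ->
  (forall n, \sum_(0 <= k < n) f k <= C) -> cvgn (series f).
Proof.
move=> f0 fC; apply: nondecreasing_is_cvgn.
  by apply: nondecreasing_series => n _ _; exact: f0.
by exists C => _ [n _ <-]; exact: fC.
Qed.

Lemma l2_rip_cvg (xi eta : nat -> H) : l2_summable xi -> l2_summable eta ->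
  cvgn (series (fun k => rip (xi k) (eta k))).
Proof.
move=> [C hC] [K hK]; apply: normed_cvg.
apply: (@bounded_series_cvg _ (C + K)) => n //=.
apply: (@le_trans _ _ (\sum_(0 <= k < n) (nsq (xi k) + nsq (eta k)))).
  by apply: ler_sum => k _; exact: rip_normr_le.
by rewrite big_split /= lerD.
Qed.

Definition rip2 (xi eta : nat -> H) : R :=
  limn (series (fun k => rip (xi k) (eta k))).
Local Notation nsq2 xi := (rip2 xi xi).

Lemma rip2_cvg (xi eta : ell2) :
  \sum_(0 <= k < n) rip (xi k) (eta k) @[n --> \oo] --> rip2 xi eta.
Proof. exact: l2_rip_cvg (l2val_summable xi) (l2val_summable eta). Qed.

Lemma rip2_unique (xi eta : ell2) (l : R) :
  \sum_(0 <= k < n) rip (xi k) (eta k) @[n --> \oo] --> l -> rip2 xi eta = l.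
Proof. by move=> h; exact: cvg_unique (@rip2_cvg xi eta) h. Qed.

Lemma nsq2_ge (xi : ell2) n : \sum_(0 <= k < n) nsq (xi k) <= nsq2 xi.
Proof.
apply: (cvgr_to_ge (@rip2_cvg xi xi)); near=> k.
have nk : (n <= k)%N by near: k; exact: nbhs_infty_ge.
rewrite (big_cat_nat _ nk)//= lerDl sumr_ge0// => i _.
exact: (ip_ge0 hilbert_rip).
Unshelve. all: by end_near. Qed.

Lemma nsq2_le (xi : ell2) C : (forall n, \sum_(0 <= k < n) nsq (xi k) <= C) ->
  nsq2 xi <= C.
Proof. by move=> h; apply: (cvgr_to_le (@rip2_cvg xi xi)); near=> k; exact: h.
Unshelve. all: by end_near. Qed.

Lemma nsq2_ge1 (xi : ell2) n : nsq (xi n) <= nsq2 xi.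
Proof.
apply: le_trans (nsq2_ge xi n.+1); rewrite big_nat_recr//= lerDr.
by rewrite sumr_ge0// => i _; exact: (ip_ge0 hilbert_rip).
Qed.

Lemma hilbert_rip2 : hilbert (fun xi eta : ell2 => rip2 xi eta).
Proof.
split.
- move=> xi eta; apply: rip2_unique; apply: eq_cvgn (@rip2_cvg eta xi) => n.
  by apply: eq_bigr => k _; rewrite (ipC hilbert_rip).
- move=> r xi eta zeta; apply: rip2_unique.
  have h : r * \sum_(0 <= k < n) rip (xi k) (zeta k) +
      \sum_(0 <= k < n) rip (eta k) (zeta k) @[n --> \oo] -->
      r * rip2 xi zeta + rip2 eta zeta.
    apply: cvgD; last exact: rip2_cvg.
    by apply: cvgM; [exact: cvg_cst|exact: rip2_cvg].
  apply: eq_cvgn h => n; rewrite mulr_sumr -big_split; apply: eq_bigr => k _.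
  by rewrite l2valD l2valZ !(ipE hilbert_rip).
- by move=> xi; apply: le_trans (nsq2_ge xi 0); rewrite big_geq.
- move=> xi xi0; apply: ell2_inj => n; apply: (ip_eq0 hilbert_rip).
  apply/eqP; rewrite eq_le (ip_ge0 hilbert_rip) andbT -xi0; exact: nsq2_ge1.
- move=> xi xiC.
  have /choice[l xil] k : exists l, hconv (@rip R H) (fun n => xi n k) l.
    apply: (ip_complete hilbert_rip) => e /xiC[N hN]; exists N => n m Nn Nm.
    by apply: le_lt_trans (hN n m Nn Nm); exact: (nsq2_ge1 (xi n - xi m)).
  (* The coordinatewise limit [l] is not known to be summable yet, so the Cauchy bound is passed to
     the limit on finite partial sums, uniformly in their length [K]. *)
  have tail e : 0 < e -> exists N, forall n, (N <= n)%N ->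
      forall K, \sum_(0 <= k < K) nsq (xi n k - l k) <= e.
    move=> /xiC[N hN]; exists N => n Nn K.
    have h : \sum_(0 <= k < K) nsq (xi n k - xi m k) @[m --> \oo] -->
        \sum_(0 <= k < K) nsq (xi n k - l k).
      apply: cvg_big => [|k _]; first exact: add_continuous.
      apply: (hconv_nsq hilbert_rip).
      apply: (hconvD hilbert_rip); first exact: (hconv_cst hilbert_rip).
      exact: (hconvN hilbert_rip (xil k)).
    apply: (cvgr_to_le h); near=> m.
    apply: le_trans (nsq2_ge (xi n - xi m) K) _; apply: ltW; apply: hN => //.
    by near: m; exact: nbhs_infty_ge.
  have lsum : l2_summable l.
    have [N hN] := tail _ ltr01.
    have h : l2_summable (fun k => xi N k - l k) by exists 1; exact: hN.
    have := l2_summableL (-1) h (l2val_summable (xi N)).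
    congr l2_summable; apply/funext => k; rewrite !fctE scaleN1r opprB.
    by rewrite subrK.
  exists (to_ell2 l); apply/cvgr0Pnorm_le => e /tail[N hN]; exists N => // n Nn.
  rewrite ger0_norm.
    by apply: nsq2_le => K; under eq_bigr do rewrite l2valB to_ell2E//; exact: hN.
  by apply: le_trans (nsq2_ge (xi n - to_ell2 l) 0); rewrite big_geq.
Unshelve. all: by end_near. Qed.

End Operators.

Section Operators.
Variables (R : realType) (H : hilbertType R).
Implicit Types (u v w : H) (a b x y : H -> H) (A M D : set (H -> H)) (r s : R).

Local Notation Re := complex.Re.
Local Notation Im := complex.Im.
Local Notation ii := (Complex (0 : R) 1).
Local Notation nsq u := (rip u u).
Local Notation symmetric_on := @symmetric_op.
Local Notation symmetric_op := (symmetric_op (@rip R H)).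
Local Notation hilbert_rip := (@hilbert_rip R H).
Local Notation nsq2 xi := (rip2 xi xi).
Local Notation ell2 := (ell2 H).
Local Notation hilbert_rip2 := (@hilbert_rip2 R H).
Local Notation ip2 := (fun xi eta : ell2 => rip2 xi eta).
Local Notation symmetric_op2 := (symmetric_on R ell2 ip2).

Lemma cvg_Re (f : nat -> R[i]^o) (l : R[i]^o) :
  f n @[n --> \oo] --> l -> Re (f n) @[n --> \oo] --> Re l.
Proof.
move=> fl; apply/cvgrPdist_lt => e e0.
have /cvgrPdist_lt/(_ e%:C) := fl; rewrite ltcR => /(_ e0).
apply: filterS => n; rewrite -ltcR; apply: le_lt_trans.
by have := normc_ge_Re (l - f n); rewrite raddfB.
Qed.

Lemma cvg_complex (f g : nat -> R) (p q : R) : f n @[n --> \oo] --> p ->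
  g n @[n --> \oo] --> q ->
  (Complex (f n) (g n) : R[i]^o) @[n --> \oo] --> (Complex p q : R[i]^o).
Proof.
move=> fp gq; apply/cvgrPdist_lt => e /pos_complex[r r0 ->].
have r2 : 0 < r / 2 by rewrite divr_gt0.
near=> n.
have -> : Complex p q - Complex (f n) (g n) = (p - f n)%:C + ii * (q - g n)%:C.
  rewrite [LHS]complexE /=.
  by [].
apply: le_lt_trans (ler_normD _ _) _.
rewrite normrM.
have nC (t : R) : `|t%:C| = `|t|%:C :> R[i].
  by rewrite normc_def /= expr0n addr0 sqrtr_sqr.
have -> : `|ii| = 1 :> R[i] by rewrite normc_def /= expr0n add0r expr1n sqrtr1.
rewrite mul1r !nC -rmorphD ltcR [ltRHS]splitr ltrD//.
  by near: n; apply: cvgr_dist_lt.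
by near: n; apply: cvgr_dist_lt.
Unshelve. all: by end_near. Qed.

Lemma sum_complex (n : nat) (f : nat -> R[i]) :
  \sum_(0 <= k < n) f k =
  Complex (\sum_(0 <= k < n) Re (f k)) (\sum_(0 <= k < n) Im (f k)).
Proof.
elim: n => [|n ih]; first by rewrite !big_geq.
by rewrite !big_nat_recr//= ih; case: (f n).
Qed.

Lemma sq_summableP (xi : nat -> H) : sq_summable xi <-> l2_summable xi.
Proof.
have E n : series (fun n => `|xi n| ^+ 2 : R[i]^o) n =
    Complex (\sum_(0 <= k < n) nsq (xi k)) 0.
  transitivity (\sum_(0 <= k < n) (`|xi k| ^+ 2 : R[i])); first by [].
  rewrite sum_complex; congr Complex.
    by apply: eq_bigr => k _; rewrite sqr_norm_nsq.
  by rewrite big1// => k _; rewrite sqr_norm_nsq.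
split=> [/cvg_Re h|[C hC]].
  exists (limn (series (fun k => nsq (xi k)))) => n.
  apply: nondecreasing_cvgn_le.
    by apply: nondecreasing_series => k _ _; exact: (ip_ge0 hilbert_rip).
  apply/cvg_ex; eexists; apply: eq_cvgn h => k.
  exact (congr1 (fun z : R[i] => Re z) (E k)).
have /cvg_ex[l hl] : cvgn (series (fun k => nsq (xi k))).
  by apply: (bounded_series_cvg _ hC) => k; exact: (ip_ge0 hilbert_rip).
apply/cvg_ex; exists (Complex l 0 : R[i]^o).
apply: eq_cvgn (cvg_complex hl (cvg_cst (0 : R))) => n.
exact (esym (E n)).
Qed.

(** The amplification of [x], usually written as [x] tensor 1. As [to_ell2] sends non-summable
    sequences to [0], the formula of [hatE] is available for bounded [x]. *)
Definition hat x (xi : ell2) : ell2 := to_ell2 (fun n => x (xi n)).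

Lemma hatE x (xi : ell2) n : bounded_op x -> hat x xi n = x (xi n).
Proof.
move=> /bounded_op_bound[C C0 xC].
have [K hK] := l2val_summable xi.
rewrite /hat to_ell2E//; exists (C * K) => k.
apply: (@le_trans _ _ (C * \sum_(0 <= i < k) nsq (xi i))).
  by rewrite mulr_sumr; apply: ler_sum => i _; exact: xC.
by rewrite ler_pM2l.
Qed.

Lemma hatL (k : R[i]) a b xi : bounded_op a -> bounded_op b ->
  hat (k *: a + b) xi = k *: hat a xi + hat b xi.
Proof.
move=> ab bb; apply: ell2_inj => n.
by rewrite l2valD l2valZ !hatE//; exact: bounded_opL.
Qed.

Lemma hatZ (k : R[i]) a xi : bounded_op a -> bounded_op (k *: a) ->
  hat (k *: a) xi = k *: hat a xi.
Proof. by move=> ab kab; apply: ell2_inj => n; rewrite l2valZ !hatE. Qed.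

Lemma hatD a b xi : bounded_op a -> bounded_op b -> bounded_op (a + b) ->
  hat (a + b) xi = hat a xi + hat b xi.
Proof. by move=> ab bb abb; apply: ell2_inj => n; rewrite l2valD !hatE. Qed.

Lemma hat_comp a b xi : bounded_op a -> bounded_op b ->
  hat (a \o b) xi = hat a (hat b xi).
Proof.
by move=> ab bb; apply: ell2_inj => n; rewrite !hatE//; exact: bounded_op_comp.
Qed.

Lemma hat_id xi : hat idfun xi = xi.
Proof.
apply: ell2_inj => n; rewrite hatE//; apply: (@bounded_opI _ _ _ 1) => // u.
by rewrite mul1r.
Qed.

Lemma hat_linear x : bounded_op x -> linear (hat x).
Proof.
move=> xb k xi eta; apply: ell2_inj => n.
by rewrite l2valD l2valZ !hatE// l2valD l2valZ (bounded_op_linear xb).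
Qed.

Lemma hat_bound x C xi : bounded_op x -> 0 <= C ->
  (forall u, nsq (x u) <= C * nsq u) -> nsq2 (hat x xi) <= C * nsq2 xi.
Proof.
move=> xb C0 xC; apply: nsq2_le => n.
apply: (@le_trans _ _ (C * \sum_(0 <= i < n) nsq (xi i))).
  by rewrite mulr_sumr; apply: ler_sum => i _; rewrite hatE.
by rewrite ler_wpM2l// nsq2_ge.
Qed.

Lemma hat_adjoint a b (xi eta : ell2) : bounded_op a -> bounded_op b ->
  is_adjoint a b -> rip2 (hat a xi) eta = rip2 xi (hat b eta).
Proof.
move=> ab bb h; apply: rip2_unique; apply: eq_cvgn (@rip2_cvg _ _ xi (hat b eta)) => n.
by apply: eq_bigr => k _; rewrite !hatE// (is_adjoint_rip _ _ h).
Qed.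

(** The real part of the predual functional of the pair [c], [c]; its imaginary part is
    [rip2 (hat x c) (ii *: c)]. *)
Definition vecfun (c : ell2) x := rip2 (hat x c) c.

Lemma predual_functionalE (xi eta : ell2) x : bounded_op x ->
  predual_functional (l2val xi, l2val eta) x =
  Complex (rip2 (hat x xi) eta) (rip2 (hat x xi) (ii *: eta)).
Proof.
move=> xb; apply: cvg_lim => //.
have h := cvg_complex (@rip2_cvg _ _ (hat x xi) eta)
  (@rip2_cvg _ _ (hat x xi) (ii *: eta)).
apply: eq_cvgn h => n.
transitivity (\sum_(0 <= k < n) (hdot (x (xi k)) (eta k) : R[i])); last by [].
by rewrite sum_complex; congr Complex; apply: eq_bigr => k _; rewrite hdotE hatE.
Qed.

Lemma sum_uniq_le (T : eqType) (F : T -> R) (s t : seq T) :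
  (forall p, 0 <= F p) -> uniq s -> uniq t -> {subset s <= t} ->
  \sum_(p <- s) F p <= \sum_(p <- t) F p.
Proof.
move=> F0 us ut st; rewrite [leRHS](bigID (mem s))/= -[leLHS]addr0 lerD//.
  rewrite -[leRHS]big_filter.
  rewrite (perm_big [seq i <- t | i \in s])//.
  apply: uniq_perm => //; first exact: filter_uniq.
  by move=> p; rewrite mem_filter; case ps: (p \in s) => //=; rewrite st.
by apply: sumr_ge0.
Qed.

(** Enumerates a double sequence; codes of no pair contribute [0]. Comparing finite sums with finite
    grids in both directions stands in for a rearrangement theorem for nonnegative double series. *)
Definition unpair (F : nat * nat -> R) (k : nat) : R :=
  oapp F 0 (pickle_inv k).

Definition grid N J : seq (nat * nat) := [seq (m, j) | m <- iota 0 N, j <- iota 0 J].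

Lemma sum_grid (F : nat * nat -> R) N J : \sum_(p <- grid N J) F p =
  \sum_(0 <= m < N) \sum_(0 <= j < J) F (m, j).
Proof. by rewrite /grid big_allpairs /index_iota !subn0. Qed.

Lemma grid_uniq N J : uniq (grid N J).
Proof. by apply: allpairs_uniq => [||[? ?] [? ?]]; rewrite ?iota_uniq. Qed.

Lemma mem_grid N J m j : ((m, j) \in grid N J) = (m < N)%N && (j < J)%N.
Proof.
apply/allpairsP/andP => [[[m' j'] /= [h1 h2 [-> ->]]]|[h1 h2]].
  by move: h1 h2; rewrite !mem_iota !add0n.
by exists (m, j); rewrite /= !mem_iota !add0n.
Qed.

Lemma sum_unpair_le (F : nat * nat -> R) C : (forall p, 0 <= F p) ->
  (forall N J, \sum_(0 <= m < N) \sum_(0 <= j < J) F (m, j) <= C) ->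
  forall K, \sum_(0 <= k < K) unpair F k <= C.
Proof.
move=> F0 FC K; pose s : seq (nat * nat) := pmap pickle_inv (iota 0 K).
have -> : \sum_(0 <= k < K) unpair F k = \sum_(p <- s) F p.
  by rewrite /s big_pmap /index_iota subn0; apply: eq_bigr => k _.
pose N := (\max_(p <- s) maxn p.1 p.2).+1.
apply: le_trans (FC N N); rewrite -sum_grid; apply: sum_uniq_le => //.
- apply: (pmap_uniq (g := pickle)) (iota_uniq _ _) => k.
  exact: pickle_invK.
- exact: grid_uniq.
- move=> [m j] ps; have : (maxn m j < N)%N.
    by rewrite ltnS (@leq_bigmax_seq _ _ _ (fun p => maxn p.1 p.2) (m, j)).
  by rewrite mem_grid gtn_max.
Qed.

Lemma sum_unpair_ge (F : nat * nat -> R) N J : (forall p, 0 <= F p) ->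
  exists K, \sum_(0 <= m < N) \sum_(0 <= j < J) F (m, j) <=
    \sum_(0 <= k < K) unpair F k.
Proof.
move=> F0; pose s := [seq pickle p | p <- grid N J].
exists (\max_(k <- s) k).+1; rewrite -sum_grid.
have -> : \sum_(p <- grid N J) F p = \sum_(k <- s) unpair F k.
  by rewrite /s big_map; apply: eq_bigr => p _; rewrite /unpair pickleK_inv.
apply: sum_uniq_le => //.
- by move=> k; rewrite /unpair; case: pickle_inv => //= p.
- by rewrite map_inj_uniq ?grid_uniq//; exact: (pcan_inj pickleK_inv).
- exact: iota_uniq.
- move=> k ks; rewrite mem_index_iota /= ltnS.
  exact: (@leq_bigmax_seq _ _ _ id k).
Qed.

(** Enumerating the pairs [(m, j)] merges all the sequences [c m] into the single square-summable
    sequence of the [c m j]. *)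
Lemma vecfun_dominated_sum (c : nat -> ell2) C :
  (forall N, \sum_(0 <= m < N) nsq2 (c m) <= C) ->
  exists d : ell2, forall x, bounded_op x -> psd_op x ->
    forall N, \sum_(0 <= m < N) vecfun (c m) x <= vecfun d x.
Proof.
move=> hC; pose d k : H := oapp (fun p : nat * nat => c p.1 p.2) 0 (pickle_inv k).
have dE (x : H -> H) k : x 0 = 0 ->
    rip (x (d k)) (d k) = unpair (fun p => rip (x (c p.1 p.2)) (c p.1 p.2)) k.
  rewrite /unpair /d; case: pickle_inv => //= ->.
  by rewrite (ip0l hilbert_rip).
have dsum : l2_summable d.
  exists C => K; under eq_bigr do rewrite (dE idfun)//.
  apply: sum_unpair_le => [p|N J]; first exact: (ip_ge0 hilbert_rip).
  by apply: le_trans (hC N); apply: ler_sum => m _; exact: (nsq2_ge (c m) J).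
exists (to_ell2 d) => x xb [xsym x0] N.
have h : \sum_(0 <= m < N) \sum_(0 <= j < J) rip (x (c m j)) (c m j)
    @[J --> \oo] --> \sum_(0 <= m < N) vecfun (c m) x.
  apply: cvg_big => [|m _]; first exact: add_continuous.
  apply: eq_cvgn (@rip2_cvg _ _ (hat x (c m)) (c m)) => J.
  by apply: eq_bigr => j _; rewrite hatE.
apply: (cvgr_to_le h); near=> J.
have [K hK] := @sum_unpair_ge (fun p => rip (x (c p.1 p.2)) (c p.1 p.2)) N J
  (fun p => x0 _).
apply: le_trans hK _.
apply: (cvgr_to_ge (@rip2_cvg _ _ (hat x (to_ell2 d)) (to_ell2 d))); near=> K'.
have KK' : (K <= K')%N by near: K'; exact: nbhs_infty_ge.
have x00 : x 0 = 0 by exact: linear0 (bounded_op_linear xb).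
rewrite (big_cat_nat _ KK')//=.
under [X in _ <= X + _]eq_bigr do rewrite hatE// to_ell2E// dE//.
rewrite lerDl sumr_ge0// => k _; rewrite hatE//; exact: x0.
Unshelve. all: by end_near. Qed.

End Operators.

(** * Positive functionals dominated by vector functionals *)

Section Operators.
Variables (R : realType) (H : hilbertType R).
Implicit Types (u v w : H) (a b x y : H -> H) (A M D : set (H -> H)) (r s : R).

Local Notation Re := complex.Re.
Local Notation Im := complex.Im.
Local Notation ii := (Complex (0 : R) 1).
Local Notation nsq u := (rip u u).
Local Notation symmetric_on := @symmetric_op.
Local Notation symmetric_op := (symmetric_op (@rip R H)).
Local Notation hilbert_rip := (@hilbert_rip R H).
Local Notation nsq2 xi := (rip2 xi xi).
Local Notation ell2 := (ell2 H).
Local Notation hilbert_rip2 := (@hilbert_rip2 R H).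
Local Notation ip2 := (fun xi eta : ell2 => rip2 xi eta).
Local Notation symmetric_op2 := (symmetric_on R ell2 ip2).

Section RadonNikodym.
Variables (M : set (H -> H)) (Mvn : von_neumann_algebra M).
Variable phi : (H -> H) -> R[i]^o.
Hypothesis phiL : linear_on M phi.
Hypothesis phi0 : forall x, M x -> positive_op x -> 0 <= phi x :> R[i].

Local Notation f x := (Re (phi x)).

Let Mb x : M x -> bounded_op x. Proof. exact: vn_bounded. Qed.

Lemma functionalZ (k : R[i]) x : M x -> phi (k *: x) = k * phi x.
Proof.
move=> Mx; have M0 := vn_0 Mvn; have := phiL k Mx M0; rewrite addr0 => ->.
have := phiL 1 M0 M0; rewrite scale1r scale1r addr0 => /eqP.
by rewrite -subr_eq0 opprD addrA subrr add0r oppr_eq0 => /eqP->; rewrite addr0.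
Qed.

Lemma functionalD x y : M x -> M y -> phi (x + y) = phi x + phi y.
Proof. by move=> Mx My; have := phiL 1 Mx My; rewrite !scale1r. Qed.

Lemma functional_self_adjoint_real x : M x -> symmetric_op x -> Im (phi x) = 0.
Proof.
move=> Mx xsym; have [C C0 xC] := bounded_op_bound (Mb Mx).
(* Large enough for [x + k] to be positive, as [|rip (x u) u| <= nsq (x u) + nsq u]. *)
pose k : R[i] := (C + 1)%:C.
have Mi := vn_id Mvn; have Mk := vnZ Mvn k Mi.
have idp : positive_op (idfun : H -> H).
  by move=> u; rewrite hdot_self ler0c (ip_ge0 hilbert_rip).
have im0 (z : R[i]) : 0 <= z -> Im z = 0 by case: z => p q; rewrite lecE /= => /andP[/eqP].
have : positive_op (x + k *: idfun).
  apply/positive_opP; first by apply: (vn_linear Mvn); exact: vnD.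
  split=> u.
    by move=> v; rewrite !fctE /= !(ipE hilbert_rip) xsym.
  rewrite !fctE /= !(ipE hilbert_rip); have := rip_normr_le (x u) u.
  by rewrite ler_norml => /andP[+ _]; have := xC u; lra.
move=> /phi0 h; have /h/im0 : M (x + k *: idfun) by exact: vnD.
rewrite functionalD// functionalZ//.
have := im0 _ (phi0 Mi idp); case: (phi idfun) => p q /= ->.
by case: (phi x) => p' q' /=; rewrite mulr0 mul0r !addr0.
Qed.

Lemma adjoint_difference_symmetric x x' : M x -> M x' -> is_adjoint x x' ->
  symmetric_op ((- ii) *: (x - x')).
Proof.
move=> Mx Mx' xx' u v.
have E z : ((- ii) *: (x - x')) z = - (ii *: (x z - x' z)) by rewrite -scaleNr.
have l1 := linearZ_op ii v (vn_linear Mvn Mx).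
have l2 := linearZ_op ii v (vn_linear Mvn Mx').
rewrite !E !(ipNl hilbert_rip) !(ipNr hilbert_rip) rip_ii opprK scalerBr -l1 -l2.
rewrite !(ipE hilbert_rip) (is_adjoint_rip _ _ xx').
by rewrite (is_adjoint_rip _ _ (is_adjoint_sym xx')) opprB addrC.
Qed.

(** [x - x'] is [ii] times a self-adjoint element, on which [phi] is real, so it contributes nothing
    to the real part. *)
Lemma functional_adjoint x x' : M x -> M x' -> is_adjoint x x' -> f x' = f x.
Proof.
move=> Mx Mx' xx'; pose b := (- ii) *: (x - x').
have Mbb : M b by apply: vnZ => //; exact: vnB.
have bsym : symmetric_op b by exact: adjoint_difference_symmetric.
have xE : x = ii *: b + x'.
  by rewrite /b scalerA mulrN -expr2 sqr_i opprK scale1r subrK.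
rewrite [in RHS]xE phiL//.
have := functional_self_adjoint_real Mbb bsym.
by case: (phi b) => p q /= ->; case: (phi x') => p' q' /=; rewrite mulr0 mul0r subr0 add0r.
Qed.

Lemma positive_adjoint_comp x x' : is_adjoint x x' -> positive_op (x' \o x).
Proof.
move=> h u /=; rewrite (is_adjoint_sym h) hdot_self ler0c.
exact: (ip_ge0 hilbert_rip).
Qed.

Variable c : ell2.
Hypothesis phic : forall x, M x -> positive_op x -> f x <= vecfun c x.

Local Notation e x := (hat x c).

Let adj x : H -> H := xget x [set b | M b /\ is_adjoint x b].

Let adjP x : M x -> M (adj x) /\ is_adjoint x (adj x).
Proof.
by move=> Mx; rewrite /adj; case: xgetP => // h; have [b Mb' xb] := vn_adjoint Mvn Mx;
   have := h b; case.
Qed.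

Let adjE x b : M x -> is_adjoint x b -> adj x = b.
Proof. by move=> Mx xb; have [_ h] := adjP Mx; exact: is_adjoint_unique h xb. Qed.

(** The real part of the GNS form of [phi]. By domination it is bounded by the inner product of the
    vectors [e x], [e y], so it comes from an operator. *)
Let B x y := f (adj x \o y).

Let adj_comp x y : M x -> M y -> is_adjoint (adj x \o y) (adj y \o x).
Proof.
move=> Mx My u v /=; have [_ /is_adjoint_sym hx] := adjP Mx.
by have [_ hy] := adjP My; rewrite hx hy.
Qed.

Let Madj x y : M x -> M y -> M (adj x \o y).
Proof. by move=> /adjP[h _] My; exact: vn_comp. Qed.

Let BC x y : M x -> M y -> B x y = B y x.
Proof.
by move=> Mx My; apply: functional_adjoint (adj_comp My Mx); exact: Madj.
Qed.

Let BL r x y z : M x -> M y -> M z -> B x (r%:C *: y + z) = r * B x y + B x z.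
Proof.
move=> Mx My Mz; have [Mx' _] := adjP Mx; rewrite /B.
have -> : adj x \o (r%:C *: y + z) = r%:C *: (adj x \o y) + (adj x \o z).
  by apply/funext => u /=; rewrite !fctE /= (vn_linear Mvn Mx').
rewrite phiL//; do ?exact: Madj.
by case: (phi _) => p q; case: (phi _) => p' q' /=; rewrite mul0r subr0.
Qed.

Let B0 x : M x -> 0 <= B x x.
Proof.
move=> Mx; have [_ h] := adjP Mx.
have := phi0 (Madj Mx Mx) (positive_adjoint_comp h).
by rewrite /B lecE => /andP[].
Qed.

Let B_le x : M x -> B x x <= nsq2 (e x).
Proof.
move=> Mx; have [Mx' h] := adjP Mx.
apply: le_trans (phic (Madj Mx Mx) (positive_adjoint_comp h)) _.
rewrite /vecfun hat_comp; do ?exact: Mb.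
by rewrite (hat_adjoint _ _ _ _ (is_adjoint_sym h)); do ?exact: Mb.
Qed.

Let Bcs x y : M x -> M y -> B x y ^+ 2 <= nsq2 (e x) * nsq2 (e y).
Proof.
move=> Mx My; apply: (@le_trans _ _ (B x x * B y y)); last first.
  by apply: ler_pM; rewrite ?B0 ?B_le.
apply: discriminant_le0 => t.
have Mxy : M (t%:C *: y + x) by exact: vn_lin.
have := B0 Mxy; rewrite BL// !(BC Mxy)// !BL// (BC My Mx).
by congr (_ <= _); ring.
Qed.

Let Msub : real_subspace M.
Proof. by split=> [|r a b Ma Mb']; [exact: vn_0|exact: vn_lin]. Qed.

Let eL : real_linear_on M (fun x => e x).
Proof. by move=> r x y Mx My; rewrite hatL//; exact: Mb. Qed.

Local Notation cl := (limit_of ip2 M (fun x => e x)).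

Let cl_eq l k : cl l -> cl k -> (forall x, M x -> rip2 (e x) l = rip2 (e x) k) ->
  l = k.
Proof. by move=> hl hk h; exact: (limit_of_unique hilbert_rip2 Msub eL hl hk h). Qed.

Let cl_hat x l : M x -> cl l -> cl (hat x l).
Proof.
move=> Mx [y [My yl]]; have [C C0 xC] := bounded_op_bound (Mb Mx).
exists (fun n => x \o y n); split=> [n|]; first exact: vn_comp.
have -> : (fun z => e z) \o (fun n => x \o y n) = hat x \o ((fun z => e z) \o y).
  by apply/funext => n /=; rewrite hat_comp//; exact: Mb.
apply: (hconv_map hilbert_rip2 (C := C) _ _ yl).
  move=> v w; apply: rlB; exact: linear_real_linear (hat_linear (Mb Mx)).
by move=> v; apply: hat_bound (Mb Mx) (ltW C0) xC.
Qed.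

(** [t x] will be [T (e x)]. Indexing by [x] instead of [e x] avoids any question of
    well-definedness on the range of [e]. *)
Let t_exists : exists t : (H -> H) -> ell2, forall x, M x ->
  [/\ cl (t x), nsq2 (t x) <= nsq2 (e x) & forall y, M y -> rip2 (e y) (t x) = B x y].
Proof.
have /choice[t tP] : forall x, exists l : ell2, M x ->
    [/\ cl l, nsq2 l <= nsq2 (e x) & forall y, M y -> rip2 (e y) l = B x y];
  last by exists t.
move=> x; have [Mx|nMx] := pselect (M x); last by exists 0.
have C0 : 0 <= nsq2 (e x) by exact: (ip_ge0 hilbert_rip2).
have [|y My|l [hl lB]] := @riesz _ _ _ hilbert_rip2 _ M (fun y => e y) (B x) _ Msub eL _ C0.
- by move=> r y z My Mz; exact: BL.
- exact: Bcs.
exists l => _; split=> //.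
apply: (limit_of_bound hilbert_rip2 C0 hl lB) => y My; exact: Bcs.
Qed.

(** A second use of Riesz, on [y |-> rip2 (t y) u], defines [T] on all of [ell2]; it vanishes on the
    orthogonal complement of the closure of [M c]. Equal vectors are recognised by [cl_eq], that is,
    by pairing with the [e y]. *)
Let T_exists : exists T : ell2 -> ell2,
  [/\ symmetric_op2 T,
   forall u : ell2, 0 <= rip2 (T u) u <= nsq2 u,
   forall x (u : ell2), M x -> hat x (T u) = T (hat x u) &
   forall x, M x -> rip2 (e x) (T c) = f x].
Proof.
have [t tP] := t_exists.
have tL : real_linear_on M t.
  move=> r x y Mx My; have Mz : M (r%:C *: x + y) by exact: vn_lin.
  have [[[cz _ hz] [cx _ hx]] [cy _ hy]] := (tP _ Mz, tP _ Mx, tP _ My).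
  apply: cl_eq => //; first exact: (limit_ofL hilbert_rip2 Msub eL).
  move=> z Mz'; rewrite hz// !(ipE hilbert_rip2) hx// hy//.
  by rewrite BC// BL// (BC Mz')// (BC Mz').
have /choice[T TP] (u : ell2) : exists l, [/\ cl l, nsq2 l <= nsq2 u &
    forall y, M y -> rip2 (e y) l = rip2 (t y) u].
  have C0 : 0 <= nsq2 u by exact: (ip_ge0 hilbert_rip2).
  have bd y : M y -> rip2 (t y) u ^+ 2 <= nsq2 u * nsq2 (e y).
    move=> My; have [_ ty _] := tP _ My.
    apply: le_trans (cauchy_schwarz hilbert_rip2 _ _) _.
    by rewrite mulrC ler_wpM2l.
  have [|y My|l [hl lB]] := @riesz _ _ _ hilbert_rip2 _ M (fun y => e y)
    (fun y => rip2 (t y) u) _ Msub eL _ C0.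
  - by move=> r y z My Mz; rewrite tL// !(ipE hilbert_rip2).
  - exact: bd.
  by exists l; split=> //; exact: (limit_of_bound hilbert_rip2 C0 hl lB bd).
have Tcl (u : ell2) : cl (T u) by case: (TP u).
have TE (u : ell2) y : M y -> rip2 (e y) (T u) = rip2 (t y) u by case: (TP u) => _ _; apply.
have Te x : M x -> T (e x) = t x.
  move=> Mx; have [tx _ hx] := tP _ Mx; apply: cl_eq => // y My.
  have [_ _ hy] := tP _ My.
  by rewrite TE// (ipC hilbert_rip2) hy// hx// BC.
have TL : real_linear_on setT T.
  move=> r u v _ _; apply: cl_eq => //; first exact: (limit_ofL hilbert_rip2 Msub eL).
  by move=> y My; rewrite TE// !(ipE hilbert_rip2) !TE.
have Tle (u : ell2) : nsq2 (T u) <= nsq2 u by case: (TP u).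
(* [p] is the projection of [u] on the closure of [M c]. Since [T u = T p], symmetry and positivity
   reduce to limits of vectors [e (y n)]. *)
have proj (u : ell2) : exists (y : nat -> H -> H) p, [/\ forall n, M (y n),
    hconv ip2 (fun n => e (y n)) p,
    T u = T p & forall l, cl l -> rip2 l p = rip2 l u].
  have [|p [[s [Ss sp]] pu]] := orthogonal_projection hilbert_rip2
      (S := [set e x | x in M]) u.
    split; first by exists 0; [exact: vn_0|apply: ell2_inj => n; rewrite hatE//;
      exact: Mb (vn_0 Mvn)].
    by move=> r _ _ [x Mx <-] [y My <-]; exists (r%:C *: x + y);
      [exact: vn_lin|rewrite eL].
  have /choice[y yP] n : exists y, M y /\ e y = s n.
    by have [y My <-] := Ss n; exists y.
  have clpu l : cl l -> rip2 l p = rip2 l u.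
    move=> hl; apply/eqP; rewrite -subr_eq0 -(ipNr hilbert_rip2) -(ipDr hilbert_rip2).
    apply/eqP; apply: (limit_of_orth hilbert_rip2 hl) => x Mx.
    by rewrite !(ipE hilbert_rip2) pu ?subrr//; exists x.
  exists y, p; split.
  - by move=> n; case: (yP n).
  - have -> : (fun n => e (y n)) = s by apply/funext => n; case: (yP n).
    exact: sp.
  - apply: cl_eq; [exact: Tcl|exact: Tcl|] => z Mz.
    by rewrite !TE// clpu//; case: (tP _ Mz).
  - exact: clpu.
have Tconv (y : nat -> H -> H) p : hconv ip2 (fun n => e (y n)) p ->
    hconv ip2 (fun n => T (e (y n))) (T p).
  move=> yp; apply: (hconv_map hilbert_rip2 (C := 1) _ _ yp).
    exact: rlB.
  by move=> v; rewrite mul1r.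
exists T; split.
- move=> u v; have [y [p [My yp -> clpu]]] := proj u.
  rewrite -[RHS](ipC hilbert_rip2) -clpu// (ipC hilbert_rip2 (T v)).
  have h : rip2 (T (e (y n))) v @[n --> \oo] --> rip2 p (T v).
    apply: eq_cvgn (hconv_ip hilbert_rip2 (w := T v) yp) => n.
    by rewrite TE// Te.
  exact: cvg_unique (hconv_ip hilbert_rip2 (w := v) (Tconv _ _ yp)) h.
- move=> u; apply/andP; split.
    have [y [p [My yp Tup clpu]]] := proj u.
    rewrite -clpu// Tup.
    apply: (cvgr_to_ge (hconv_ip2 hilbert_rip2 (Tconv _ _ yp) yp)).
    near=> n; rewrite Te// (ipC hilbert_rip2); have [_ _ ->//] := tP _ (My n).
    exact: B0.
  have := ip_le_of_nsq hilbert_rip2 ler01 ler01 (w := u) (u := T u) (v := u).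
  by rewrite expr1n !mul1r; apply.
- move=> x u Mx; have [Mx' xx'] := adjP Mx.
  have xx's := is_adjoint_sym xx'.
  apply: cl_eq; [exact: cl_hat|exact: Tcl|] => y My.
  have [ty _ hy] := tP _ My.
  have Mx'y : M (adj x \o y) by exact: vn_comp.
  rewrite TE// (ipC hilbert_rip2) (hat_adjoint _ _ (Mb Mx) (Mb Mx') xx').
  rewrite -hat_comp; [|exact: Mb..].
  rewrite (ipC hilbert_rip2) TE// (ipC hilbert_rip2 (t y)).
  rewrite (hat_adjoint _ _ (Mb Mx) (Mb Mx') xx') (ipC hilbert_rip2 u).
  (* What remains is [t (adj x \o y) = hat (adj x) (t y)]; paired with [e z], it reads
     [B (adj x \o y) z = B y (x \o z)]. *)
  congr rip2; congr (l2val _); have [tx'y _ hx'y] := tP _ Mx'y.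
  apply: cl_eq => //; first exact: cl_hat.
  move=> z Mz; rewrite hx'y//.
  rewrite -(hat_adjoint _ _ (Mb Mx) (Mb Mx') xx') -hat_comp; [|exact: Mb..].
  rewrite hy; last exact: vn_comp.
  rewrite /B (@adjE (adj x \o y) (adj y \o x))//.
  exact: adj_comp.
- move=> x Mx; have Mi := vn_id Mvn.
  have [_ _ h] := tP _ Mi.
  have -> : T c = t idfun by rewrite -Te// hat_id.
  rewrite h// /B; congr (Re (phi _)).
  by rewrite (@adjE idfun idfun).
Unshelve. all: by end_near. Qed.

Lemma radon_nikodym : exists d : ell2, forall x, M x ->
  phi x = Complex (vecfun d x) (rip2 (hat x d) (ii *: d)).
Proof.
have [T [Tsym T01 Tx Tf]] := T_exists.
have [|S [Ssym S0 ST SZ]] := symmetric_sqrt hilbert_rip2 Tsym ltr01.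
  by move=> u; rewrite mul1r.
have fS x : M x -> f x = vecfun (S c) x.
  move=> Mx; rewrite -Tf// -ST -Ssym.
  have [C C0 xC] := bounded_op_bound (Mb Mx).
  rewrite -(SZ (hat x) C)//.
  - by exact: linear_real_linear (hat_linear (Mb Mx)).
  - by move=> u; exact: hat_bound (Mb Mx) (ltW C0) xC.
  - by move=> u; exact: Tx.
exists (S c) => x Mx.
have <- := fS _ Mx.
(* The imaginary part of [phi x] is [- f (ii *: x)], so the formula for real parts, applied to
   [ii *: x], gives the rest. *)
have -> : rip2 (hat x (S c)) (ii *: S c) = - vecfun (S c) (ii *: x).
  apply: rip2_unique.
  have Mix := vnZ Mvn ii Mx.
  have h : - (\sum_(0 <= k < n) rip (hat (ii *: x) (S c) k) (S c k)) @[n --> \oo]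
     --> - vecfun (S c) (ii *: x).
    by apply: cvgN; exact: rip2_cvg.
  apply: eq_cvgn h => n; rewrite -sumrN; apply: eq_bigr => k _.
  rewrite l2valZ rip_iir; congr (- rip _ _).
  by rewrite !hatE//; [exact: Mb|exact: Mb Mix].
rewrite -fS; last exact: vnZ.
rewrite functionalZ//; case: (phi x) => p q /=.
by congr Complex; ring.
Qed.

End RadonNikodym.

End Operators.

Section Operators.
Variables (R : realType) (H : hilbertType R).
Implicit Types (u v w : H) (a b x y : H -> H) (A M D : set (H -> H)) (r s : R).

Local Notation Re := complex.Re.
Local Notation Im := complex.Im.
Local Notation ii := (Complex (0 : R) 1).
Local Notation nsq u := (rip u u).
Local Notation symmetric_on := @symmetric_op.
Local Notation symmetric_op := (symmetric_op (@rip R H)).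
Local Notation hilbert_rip := (@hilbert_rip R H).
Local Notation nsq2 xi := (rip2 xi xi).
Local Notation ell2 := (ell2 H).
Local Notation hilbert_rip2 := (@hilbert_rip2 R H).
Local Notation ip2 := (fun xi eta : ell2 => rip2 xi eta).
Local Notation symmetric_op2 := (symmetric_on R ell2 ip2).

(** * The weak* topology and domination of normal functionals *)

Section WeakStar.
Implicit Types (i : @predual_index R H).

Local Notation pf i := (predual_functional (sval i)).
Local Notation WS := (weak_star H).

Lemma weak_star_cvg (F : set_system (H -> H)) y : Filter F ->
  (forall i, pf i x @[x --> F] --> pf i y) -> F --> (y : WS).
Proof.
move=> FF h; apply/cvg_sup => i A /= [_ [[B Bop <-] /= Bfs sBfA]].
have : nbhs (pf i y) B by apply: open_nbhs_nbhs.
by move=> /(h i) hB; apply: (@filterS _ F _ _ _ sBfA hB).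
Qed.

Lemma predual_continuous i : continuous (pf i : WS -> R[i]^o).
Proof.
move=> y.
have [h _] := @cvg_sup _ _ (fun i : @predual_index R H =>
  Topological.class (initial_topology (pf i))) (nbhs (y : WS)) y _.
have {}h := h (fun _ => id) i.
move=> A hA; have h2 := @initial_continuous _ _ (pf i) y A hA.
exact: (h _ h2).
Qed.

(** The sets given by such finite sums form a filter base converging to [0], so each neighbourhood
    contains one. Summing over [s] leaves a single inequality, ready to be dominated by one vector
    functional. *)
Lemma weak_star_nbhs0 (U : set (H -> H)) : nbhs (0 : WS) U ->
  exists (s : seq (@predual_index R H)) (e : R), 0 < e /\
    forall x, \sum_(i <- s) `|pf i x - pf i 0| < e%:C -> U x.
Proof.
pose B (q : seq (@predual_index R H) * R) :=
  [set x : H -> H | \sum_(i <- q.1) `|pf i x - pf i 0| < q.2%:C].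
pose F := filter_from [set q : seq (@predual_index R H) * R | 0 < q.2] B.
have sum0 (s : seq (@predual_index R H)) x :
    0 <= \sum_(i <- s) `|pf i x - pf i 0| by exact: sumr_ge0.
have FF : Filter F.
  apply: filter_from_filter; first by exists ([::], 1) => /=.
  move=> [s1 e1] [s2 e2] /= e10 e20; exists (s1 ++ s2, Num.min e1 e2) => /=.
    by rewrite lt_min e10.
  move=> x; rewrite /B /= big_cat /= => h; split => /=.
    apply: (@lt_le_trans _ _ (Num.min e1 e2)%:C); last by rewrite lecR ge_min lexx.
    by apply: le_lt_trans h; rewrite lerDl.
  apply: (@lt_le_trans _ _ (Num.min e1 e2)%:C); last by rewrite lecR ge_min lexx orbT.
  by apply: le_lt_trans h; rewrite lerDr.
have F0 : F --> (0 : WS).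
  apply: weak_star_cvg => i; apply/cvgrPdist_lt => e /pos_complex[r r0 ->].
  exists ([:: i], r) => // x; rewrite /B /= big_seq1.
  by rewrite distrC.
by move=> /F0 [[s e] /= e0 hU]; exists s, e.
Qed.

End WeakStar.

Lemma vecfun_ge0 c x : bounded_op x -> psd_op x -> 0 <= vecfun c x.
Proof.
move=> xb [_ x0]; apply: (cvgr_to_ge (@rip2_cvg _ _ (hat x c) c)); near=> n.
by rewrite sumr_ge0// => k _; rewrite hatE.
Unshelve. all: by end_near. Qed.

Lemma vecfunZ r c x : bounded_op x -> vecfun (r%:C *: c) x = r ^+ 2 * vecfun c x.
Proof.
move=> xb; rewrite /vecfun (linearZ_op _ _ (hat_linear xb)).
by rewrite !(ipE hilbert_rip2) mulrA.
Qed.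

Lemma vecfun_sumD (c1 c2 : ell2) : exists d : ell2, forall x, bounded_op x -> psd_op x ->
  vecfun c1 x + vecfun c2 x <= vecfun d x.
Proof.
pose c m : ell2 := if m is 0%N then c1 else if m is 1%N then c2 else 0.
have S2 (G : ell2 -> R) N : G 0 = 0 ->
    \sum_(0 <= m < N.+2) G (c m) = G c1 + G c2.
  move=> G0; rewrite !big_nat_recl//= [X in _ + (_ + X)]big1 ?addr0// => m _.
have [|d hd] := @vecfun_dominated_sum _ _ c (nsq2 c1 + nsq2 c2).
  move=> N; have := @S2 (fun xi => nsq2 xi) N; rewrite (ip0l hilbert_rip2) => <- //.
  rewrite (big_cat_nat _ (leqW (leqnSn N)))//= lerDl sumr_ge0// => m _.
  exact: (ip_ge0 hilbert_rip2).
exists d => x xb x0; have := hd x xb x0 2; rewrite (@S2 (fun xi => vecfun xi x))//.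
by rewrite /vecfun (ip0r hilbert_rip2).
Qed.

Lemma vecfun_cross (xi eta : ell2) x : bounded_op x -> psd_op x ->
  `|rip2 (hat x xi) eta| <= vecfun xi x + vecfun eta x.
Proof.
move=> xb xp; have [xsym _] := xp; have xl := hat_linear xb.
have xl' := linear_real_linear xl.
have xadj : is_adjoint x x by apply/symmetric_adjoint => //; exact: bounded_op_linear.
have hs := hat_adjoint eta xi xb xb xadj.
have h1 := vecfun_ge0 (xi + eta) xb xp; have h2 := vecfun_ge0 (xi - eta) xb xp.
have h3 := vecfun_ge0 xi xb xp; have h4 := vecfun_ge0 eta xb xp.
move: h1 h2 h3 h4; rewrite /vecfun (rlD xl') (rlB xl') !(ipE hilbert_rip2).
rewrite hs (ipC hilbert_rip2 eta) ler_norml => *.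
by apply/andP; split; lra.
Qed.

Lemma rip2_ii (xi eta : ell2) : rip2 (ii *: xi) eta = - rip2 xi (ii *: eta).
Proof.
apply: rip2_unique.
have h : - (\sum_(0 <= k < n) rip (xi k) ((ii *: eta) k)) @[n --> \oo]
    --> - rip2 xi (ii *: eta) by apply: cvgN; exact: rip2_cvg.
apply: eq_cvgn h => n; rewrite -sumrN; apply: eq_bigr => k _.
by rewrite !l2valZ rip_ii.
Qed.

Lemma vecfun_ii (xi : ell2) x : bounded_op x -> vecfun (ii *: xi) x = vecfun xi x.
Proof.
move=> xb; have := hat_linear xb ii xi 0; rewrite !addr0 => xl.
rewrite /vecfun xl (rl0 (linear_real_linear (hat_linear xb))) addr0 rip2_ii.
by rewrite scalerA -expr2 sqr_i scaleN1r (ipNr hilbert_rip2) opprK.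
Qed.

Lemma predual_functional0 p : predual_functional p (0 : H -> H) = 0 :> R[i]^o.
Proof.
apply: cvg_lim => //; apply: (eq_cvgn (f := fun=> 0 : R[i]^o)); last exact: cvg_cst.
move=> n; apply: esym; apply: big1 => k _.
have -> : (0 : H -> H) (p.1 k) = 0 *: (0 : H) by rewrite scale0r.
by rewrite hdotZl mul0r.
Qed.

Lemma predual_functional_le (p : (nat -> H) * (nat -> H)) :
  l2_summable p.1 -> l2_summable p.2 ->
  exists d : ell2, forall x, bounded_op x -> psd_op x ->
    `|predual_functional p x : R[i]| <= (vecfun d x)%:C.
Proof.
case: p => xi eta /= h1 h2; have [d hd] := vecfun_sumD (to_ell2 xi) (to_ell2 eta).
(* [d] bounds the real and the imaginary part separately; their sum needs twice its functional. *)
have [d' hd'] := vecfun_sumD d d.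
exists d' => x xb xp.
have -> : (xi, eta) = (l2val (to_ell2 xi), l2val (to_ell2 eta)).
  by rewrite !to_ell2E.
rewrite predual_functionalE//.
rewrite [X in `|X|]complexE /=; apply: le_trans (ler_normD _ _) _; rewrite normrM.
have nC (t : R) : `|t%:C| = `|t|%:C :> R[i].
  by rewrite normc_def /= expr0n addr0 sqrtr_sqr.
have -> : `|ii| = 1 :> R[i] by rewrite normc_def /= expr0n add0r expr1n sqrtr1.
rewrite mul1r !nC -rmorphD lecR (le_trans _ (hd' x xb xp))//.
have := vecfun_cross (to_ell2 xi) (ii *: to_ell2 eta) xb xp; rewrite vecfun_ii//.
have := vecfun_cross (to_ell2 xi) (to_ell2 eta) xb xp.
have := hd x xb xp; lra.
Qed.

Lemma sum_predual_le (s : seq (@predual_index R H)) :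
  exists d : ell2, forall x, bounded_op x -> psd_op x ->
    \sum_(i <- s) `|predual_functional (sval i) x : R[i]| <= (vecfun d x)%:C.
Proof.
elim: s => [|i s [d hd]].
  exists 0 => x xb xp; rewrite big_nil; have := vecfun_ge0 0 xb xp.
  by rewrite -lecR.
have [d1 hd1] := predual_functional_le (iffLR (sq_summableP _) (svalP i).1)
  (iffLR (sq_summableP _) (svalP i).2).
have [d2 hd2] := vecfun_sumD d1 d.
exists d2 => x xb xp; rewrite big_cons.
apply: (@le_trans _ _ (vecfun d1 x + vecfun d x)%:C); last by rewrite lecR hd2.
by rewrite rmorphD lerD ?hd ?hd1.
Qed.

(** Continuity at [0] gives [|w x| < 1] for positive [x] in [M] with [vecfun d x < e]. If
    [vecfun d x < e * Re (w x)], dividing [x] by [Re (w x)] contradicts this: the rescaled element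
    satisfies the condition while [w] has real part 1 there. *)
Lemma normal_dominated M (w : (H -> H) -> R[i]^o) :
  von_neumann_algebra M -> linear_on M w -> normal_functional M w ->
  exists d : ell2, forall x, M x -> positive_op x -> Re (w x) <= vecfun d x.
Proof.
move=> Mvn wL /subspace_continuousP wC.
have M0 := vn_0 Mvn.
have w0 : w 0 = 0.
  by have := functionalZ Mvn wL 0 M0; rewrite scale0r mul0r.
have /cvgrPdist_lt/(_ 1 ltr01) := wC 0 M0.
move=> /weak_star_nbhs0[s [e [e0 he]]].
have [d hd] := sum_predual_le s.
exists ((Num.sqrt e^-1)%:C *: d) => x Mx xp.
have xb := vn_bounded Mvn Mx.
have xpsd : psd_op x by apply/positive_opP => //; exact: bounded_op_linear.
have e1 : 0 <= e^-1 by rewrite invr_ge0 ltW.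
rewrite vecfunZ// sqr_sqrtr// ler_pdivlMl//.
rewrite leNgt; apply/negP => h.
have v0 := vecfun_ge0 d xb xpsd.
have r0 : 0 < Re (w x).
  by rewrite -(pmulr_rgt0 _ e0); exact: le_lt_trans h.
pose t : R := (Re (w x))^-1; have t0 : 0 < t by rewrite invr_gt0.
have Mtx : M (t%:C *: x) by exact: vnZ.
have txb := vn_bounded Mvn Mtx.
have txp : psd_op (t%:C *: x).
  case: xpsd => xsym x0; split=> u; first by move=> v; rewrite !fctE !(ipE hilbert_rip) xsym.
  by rewrite !fctE !(ipE hilbert_rip) mulr_ge0// ltW.
have vecfunt : vecfun d (t%:C *: x) = t * vecfun d x.
  rewrite /vecfun; have := hatL t%:C d xb (vn_bounded Mvn M0); rewrite addr0 => ->.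
  rewrite (_ : hat 0 d = 0) ?addr0 ?(ipZl hilbert_rip2)//.
  by apply: ell2_inj => n; rewrite hatE//; exact: (vn_bounded Mvn M0).
have lt_e : \sum_(i <- s) `|predual_functional (sval i) (t%:C *: x) -
    predual_functional (sval i) 0 : R[i]| < e%:C.
  under eq_bigr do rewrite predual_functional0 subr0.
  by apply: le_lt_trans (hd _ txb txp) _; rewrite ltcR vecfunt ltr_pdivrMl// mulrC.
have lt1 : `|w 0 - w (t%:C *: x) : R[i]| < 1 := he _ lt_e Mtx.
move: lt1; rewrite w0 sub0r normrN (functionalZ Mvn wL)//; apply/negP.
rewrite -real_leNgt ?real1// ?normr_real//.
apply: le_trans (normc_ge_Re _); rewrite (_ : Re _ = 1) ?normr1//.
case: (w x) r0 @t {t0 Mtx txb txp vecfunt h lt_e} => p q /= p0.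
by rewrite mul0r subr0 mulVf// gt_eqF.
Qed.

Lemma dominated_predual M (phi : (H -> H) -> R[i]^o) (c : ell2) :
  von_neumann_algebra M -> linear_on M phi ->
  (forall x, M x -> positive_op x -> 0 <= phi x :> R[i]) ->
  (forall x, M x -> positive_op x -> Re (phi x) <= vecfun c x) ->
  exists d : ell2, (forall x, M x -> phi x = predual_functional (l2val d, l2val d) x) /\
    forall x, M x -> Re (phi x) = vecfun d x.
Proof.
move=> Mvn phiL phi0 phic; have [d hd] := radon_nikodym Mvn phiL phi0 phic.
exists d; split=> x Mx; rewrite hd// predual_functionalE//.
exact: (vn_bounded Mvn Mx).
Qed.

End Operators.

(** * The conditional expectation *)

Section Operators.
Variables (R : realType) (H : hilbertType R).
Implicit Types (u v w : H) (a b x y : H -> H) (A M D : set (H -> H)) (r s : R).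

Local Notation Re := complex.Re.
Local Notation Im := complex.Im.
Local Notation ii := (Complex (0 : R) 1).
Local Notation nsq u := (rip u u).
Local Notation symmetric_on := @symmetric_op.
Local Notation symmetric_op := (symmetric_op (@rip R H)).
Local Notation hilbert_rip := (@hilbert_rip R H).
Local Notation nsq2 xi := (rip2 xi xi).
Local Notation ell2 := (ell2 H).
Local Notation hilbert_rip2 := (@hilbert_rip2 R H).
Local Notation ip2 := (fun xi eta : ell2 => rip2 xi eta).
Local Notation symmetric_op2 := (symmetric_on R ell2 ip2).

Section FaithfulState.
Variables (M D : set (H -> H)) (w : (H -> H) -> R[i]^o).
Hypotheses (Mvn : von_neumann_algebra M) (Dvn : von_neumann_algebra D).
Hypotheses (DM : D `<=` M) (wL : linear_on M w).
Hypothesis w0 : forall x, M x -> positive_op x -> 0 <= w x :> R[i].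
Hypothesis wD : faithful_on D w.
Variable zeta : ell2.
Hypothesis wzeta : forall x, M x -> Re (w x) = vecfun zeta x.

Local Notation rho x := (Re (w x)).
Local Notation e x := (hat x zeta).

Lemma psd_positive x : M x -> psd_op x -> positive_op x.
Proof. by move=> Mx xp; apply/(positive_opP (vn_linear Mvn Mx)). Qed.

Lemma rho_ge0 x : M x -> psd_op x -> 0 <= rho x.
Proof.
by move=> Mx xp; have := w0 Mx (psd_positive Mx xp); rewrite lecE => /andP[].
Qed.

Lemma psd_faithful x : D x -> psd_op x -> rho x = 0 -> forall u, x u = 0.
Proof.
move=> Dx xp xr u; have Mx := DM Dx.
suff -> : x = 0 by [].
apply: wD => //; first exact: psd_positive.
have := w0 Mx (psd_positive Mx xp); rewrite lecE xr /= => /andP[/eqP + _].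
by case: (w x) xr => p q /= -> ->.
Qed.

(** For [d] in [D] this yields [nsq (d u) <= C * nsq2 (e d)], so convergence at [zeta] carries over
    to [u]. *)
Definition state_bounded u :=
  exists C, forall d, D d -> psd_op d -> rip (d u) u <= C * rho d.

Lemma state_bounded_sub : real_subspace state_bounded.
Proof.
split.
  exists 0 => d Dd _; rewrite (ip0r hilbert_rip) mul0r//.
move=> r u v [C uC] [K vK]; exists (2 * r ^+ 2 * C + 2 * K) => d Dd dp.
have [dsym d0] := dp; have dl := linear_real_linear (vn_linear Dvn Dd).
have := uC d Dd dp; have := vK d Dd dp; have := d0 (r%:C *: u - v).
rewrite (rlB dl) (rlD dl) !(rlZ dl) !(ipE hilbert_rip) (dsym v u) (ipC hilbert_rip v).
have := sqr_ge0 r; nra.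
Qed.

(** With [s] the square root of [d], [rip (d (t u)) (t u)] is the squared norm of
    [s (t u) = t (s u)]. *)
Lemma state_bounded_commutant t u : commutant D t -> state_bounded u ->
  state_bounded (t u).
Proof.
move=> Dt [C uC]; have [K K0 tK] := bounded_op_bound (commutant_bounded Dt).
exists (K * C) => d Dd dp.
have [s [Ds ssym] [s0 [sd _]]] := vn_symmetric_sqrt Dvn Dd dp.1 dp.2.
have E v : rip (d v) v = nsq (s v) by rewrite -sd /= ssym.
rewrite E (vn_commute _ Dt Ds) (le_trans (tK _))// -mulrA ler_pM2l// -E.
exact: uC.
Qed.

Lemma state_bounded_zeta k : state_bounded (zeta k).
Proof.
exists 1 => d Dd [_ d0]; rewrite mul1r wzeta; last exact: DM.
have db := vn_bounded Dvn Dd.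
apply: (cvgr_to_ge (@rip2_cvg _ _ (hat d zeta) zeta)); near=> n.
have kn : (k < n)%N by near: n; exact: nbhs_infty_gt.
rewrite (big_cat_nat _ kn)//= big_nat_recr//= hatE// addrAC lerDr addr_ge0//.
  by rewrite sumr_ge0// => i _; rewrite hatE.
by rewrite sumr_ge0// => i _; rewrite hatE.
Unshelve. all: by end_near. Qed.

(* The projection onto the orthogonal complement of the state-bounded vectors
   belongs to [D] and kills [zeta], hence vanishes as [w] is faithful on [D]. *)
Lemma state_bounded_dense u : limit_of (@rip R H) state_bounded id u.
Proof.
have Ssub := state_bounded_sub.
have idL : real_linear_on state_bounded (@id H) by move=> r a b _ _.
have /choice[p pP] v := orthogonal_projection hilbert_rip v Ssub.
have plim v : limit_of (@rip R H) state_bounded id (p v) by case: (pP v).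
have pS v z : state_bounded z -> rip z (p v) = rip z v by case: (pP v) => _; apply.
have pp v z : rip (p v) z = rip (p v) (p z).
  apply/eqP; rewrite -subr_eq0 -(ipNr hilbert_rip) -(ipDr hilbert_rip); apply/eqP.
  apply: (limit_of_orth hilbert_rip (plim v)) => s Ss.
  by rewrite !(ipE hilbert_rip) pS// subrr.
have psym : symmetric_op p.
  by move=> v z; rewrite pp (ipC hilbert_rip) -pp (ipC hilbert_rip).
have ple v : nsq (p v) <= nsq v.
  have := cauchy_schwarz hilbert_rip (p v) v; rewrite pp.
  have := ip_ge0 hilbert_rip (p v); rewrite le_eqVlt => /orP[/eqP<- _|p0].
    exact: (ip_ge0 hilbert_rip).
  by rewrite expr2 ler_pM2l.
pose q v := v - p v.
have qsym : symmetric_op q by move=> v z; rewrite /q !(ipE hilbert_rip) psym.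
have q0 v : 0 <= rip (q v) v.
  by rewrite /q !(ipE hilbert_rip) pp subr_ge0.
have Dq : D q.
  apply: (vn_symmetric_mem Dvn qsym (C := 4)) => [v|t v Dt].
    have := nsqD_le hilbert_rip v (- p v); rewrite (nsqN hilbert_rip).
    by have := ple v; rewrite /q; lra.
  have tl := linear_real_linear (bounded_op_linear (commutant_bounded Dt)).
  rewrite /q (rlB tl); congr (_ - _).
  (* The adjoint [t'] is in the commutant as well, so [t] and [t'] both preserve the state-bounded
     vectors; pairing with these identifies [t (p v)] and [p (t v)]. *)
  have [t' tb' tt'] := adjoint_exists (commutant_bounded Dt).
  have Dt' := commutant_adjoint Dvn Dt tt' tb'.
  apply: (limit_of_unique hilbert_rip Ssub idL (plim _)) => [|s Ss].
    have [y [Sy yp]] := plim v; exists (fun n => t (y n)); split.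
      by move=> n; exact: state_bounded_commutant.
    have [K _ tK] := bounded_op_bound (commutant_bounded Dt).
    by apply: (hconv_map hilbert_rip _ tK yp) => ? ?; exact: rlB.
  rewrite pS// -(is_adjoint_rip _ _ (is_adjoint_sym tt')).
  rewrite -(is_adjoint_rip _ _ (is_adjoint_sym tt')) pS//.
  exact: state_bounded_commutant.
have qzeta k : q (zeta k) = 0.
  apply/eqP; rewrite subr_eq0; apply/eqP.
  apply: (limit_of_unique hilbert_rip Ssub idL _ (plim _)) => [|s Ss].
    by apply: (limit_ofI hilbert_rip id); exact: state_bounded_zeta.
  by rewrite pS.
have qE : forall v, q v = 0.
  apply: psd_faithful => //; rewrite wzeta; last exact: DM.
  apply: rip2_unique; apply: (eq_cvgn (f := fun=> 0)); last exact: cvg_cst.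
  move=> n; apply: esym; apply: big1 => k _; rewrite hatE ?qzeta ?(ip0l hilbert_rip)//.
  exact: (vn_bounded Dvn).
by have /eqP := qE u; rewrite subr_eq0 => /eqP->.
Qed.

Lemma rip2_rho x y : M x -> M y -> symmetric_op x -> rip2 (e y) (e x) = rho (x \o y).
Proof.
move=> Mx My xsym; have [xb yb] := (vn_bounded Mvn Mx, vn_bounded Mvn My).
rewrite wzeta; last exact: vn_comp.
rewrite /vecfun hat_comp//; apply: esym; apply: hat_adjoint => //.
by apply/symmetric_adjoint => //; exact: bounded_op_linear.
Qed.

Lemma symmetricB x y : symmetric_op x -> symmetric_op y -> symmetric_op (x - y).
Proof. by move=> hx hy u v; rewrite !fctE !(ipE hilbert_rip) hx hy. Qed.

Lemma strong_limit (h : nat -> H -> H) l :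
  (forall n, [/\ D (h n), psd_op (h n) & forall u, rip (h n u) u <= nsq u]) ->
  hconv ip2 (fun n => e (h n)) l ->
  exists k, [/\ D k, psd_op k & e k = l].
Proof.
move=> hP hl.
have hb n : bounded_op (h n) by have [? _ _] := hP n; exact: vn_bounded Dvn _ _.
have h1 n u : nsq (h n u) <= nsq u.
  have [_ [hs h0] hle] := hP n.
  have hle' v : 0 <= rip (h n v) v <= 1 * nsq v by rewrite h0 mul1r hle.
  by have := nsq_symmetric_le hilbert_rip hs hle' u; rewrite mul1r => /le_trans; apply.
have hlin n := linear_real_linear (bounded_op_linear (hb n)).
have cauchy u : forall r, 0 < r -> exists N, forall n m, (N <= n)%N -> (N <= m)%N ->
    nsq (h n u - h m u) < r.
  move=> r r0; have [b [Bb /cvgr0Pnorm_lt bu]] := state_bounded_dense u.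
  (* The constants fit [2 * (r / 4) + 2 * (2 + 2) * (r / 16) = r]: the first term is the difference
     at [v], the second the cost of replacing [u] by [v] under contractions. [|C| + 1] is a positive
     substitute for [C]. *)
  have [|N0 _ /(_ N0 (leqnn _)) hN0] := bu (r / 16); first by rewrite divr_gt0.
  have {hN0} := le_lt_trans (ler_norm _) hN0; set v := b N0 => vu.
  have [C vC] := Bb N0.
  have C1 : 0 < `|C| + 1 by rewrite ltr_wpDl.
  have /cvgr0Pnorm_lt hl' := hl.
  have [|N1 _ hN1] := hl' (r / (16 * (`|C| + 1))); first by rewrite divr_gt0// mulr_gt0.
  exists N1 => n m Nn Nm.
  have [Dn [sn _] _] := hP n; have [Dm [sm _] _] := hP m.
  have Dnm := vnB Dvn Dn Dm; have snm := symmetricB sn sm.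
  have Dsq := vn_comp Dvn Dnm Dnm.
  have sqp : psd_op ((h n - h m) \o (h n - h m)).
    split=> [y z|y] /=; first by rewrite !snm.
    by rewrite snm; exact: (ip_ge0 hilbert_rip).
  have hv : nsq (h n v - h m v) <= C * nsq2 (e (h n) - e (h m)).
    have := vC _ Dsq sqp; rewrite /= snm => /le_trans; apply.
    rewrite -rip2_rho//; [|exact: DM..].
    have := hatL (-1) zeta (hb m) (hb n); rewrite !scaleN1r ![- _ + _]addrC => ->.
    by rewrite lexx.
  have n1 : nsq2 (e (h n) - e (h m)) <= r / (4 * (`|C| + 1)).
    apply: le_trans (nsqB_le hilbert_rip2 l _ _) _.
    have := le_lt_trans (ler_norm _) (hN1 n Nn).
    have := le_lt_trans (ler_norm _) (hN1 m Nm).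
    have -> : r / (4 * (`|C| + 1)) = 4 * (r / (16 * (`|C| + 1))).
      by field; rewrite gt_eqF.
    by move=> /= h2 h3; lra.
  have hv2 : nsq (h n v - h m v) <= r / 4.
    apply: le_trans hv _; have := ler_norm C => C2.
    have e0 := ip_ge0 hilbert_rip2 (e (h n) - e (h m)).
    apply: (@le_trans _ _ ((`|C| + 1) * nsq2 (e (h n) - e (h m)))).
      by rewrite ler_wpM2r//; lra.
    rewrite mulrC -ler_pdivlMr//; apply: le_trans n1 _.
    by rewrite invfM mulrA lexx.
  have -> : h n u - h m u = (h n v - h m v) + (h m (v - u) - h n (v - u)).
    rewrite !(rlB (hlin _)) opprB; apply: esym.
    by rewrite addrA [X in X + _]addrA subrK addrC addrA subrK.
  apply: le_lt_trans (nsqD_le hilbert_rip _ _) _.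
  have := nsqD_le hilbert_rip (h m (v - u)) (- h n (v - u)).
  rewrite (nsqN hilbert_rip); have := h1 n (v - u); have := h1 m (v - u).
  by move: vu; rewrite /=; lra.
have /choice[k kP] u : exists v, hconv (@rip R H) (fun n => h n u) v.
  by apply: (ip_complete hilbert_rip); exact: cauchy.
have ksym : symmetric_op k.
  move=> u v; rewrite (ipC hilbert_rip u).
  have c : rip (h n u) v @[n --> \oo] --> rip (k v) u.
    apply: eq_cvgn (hconv_ip hilbert_rip (w := u) (kP v)) => n.
    by rewrite (ipC hilbert_rip); have [_ [-> _] _] := hP n.
  exact: cvg_unique (hconv_ip hilbert_rip (w := v) (kP u)) c.
have k1 u : nsq (k u) <= 1 * nsq u.
  rewrite mul1r; apply: (cvgr_to_le (hconv_nsq hilbert_rip (kP u))); near=> n.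
  exact: h1.
have k0 u : 0 <= rip (k u) u.
  apply: (cvgr_to_ge (hconv_ip hilbert_rip (w := u) (kP u))); near=> n.
  by have [_ [_ h0] _] := hP n.
have Dk : D k.
  apply: (vn_symmetric_mem Dvn ksym k1) => t u Dt.
  apply: (hconv_unique hilbert_rip (kP (t u))).
  have -> : (fun n => h n (t u)) = (fun n => t (h n u)).
    by apply/funext => n; apply: (vn_commute _ Dt); case: (hP n).
  have [K _ tK] := bounded_op_bound (commutant_bounded Dt).
  apply: (hconv_map hilbert_rip _ tK (kP u)) => ? ?.
  exact: rlB (linear_real_linear (bounded_op_linear (commutant_bounded Dt))) _ _.
exists k; split=> //; apply: ell2_inj => n; rewrite hatE; last exact: (vn_bounded Dvn).
apply: (hconv_unique hilbert_rip (kP (zeta n))).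
apply: (hconv_le hilbert_rip (C := 1) _ hl) => i; rewrite mul1r.
by have := nsq2_ge1 (e (h i) - l) n; rewrite l2valB hatE.
Unshelve. all: by end_near. Qed.


Lemma rhoD x y : M x -> M y -> rho (x + y) = rho x + rho y.
Proof.
move=> Mx My; rewrite (functionalD wL)//.
by case: (w x) => p q; case: (w y).
Qed.

Lemma rhoN x : M x -> rho (- x) = - rho x.
Proof.
move=> Mx; rewrite -scaleN1r (functionalZ Mvn wL)// mulN1r.
by case: (w x).
Qed.

Lemma rhoB x y : M x -> M y -> rho (x - y) = rho x - rho y.
Proof. by move=> Mx My; rewrite rhoD ?rhoN//; exact: vnN. Qed.

Hypothesis wC : forall d x, D d -> M x -> w (d \o x) = w (x \o d).

(** A product of positive operators need not be positive, but with [s] the square root of [m] in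
    [D], [wC] turns [w (s s x)] into [w (s x s)]. Both truncations rest on this. *)
Lemma rho_comp_ge0 m x : D m -> psd_op m -> M x -> psd_op x -> 0 <= rho (m \o x).
Proof.
move=> Dm mp Mx [xsym x0].
have [s [Ds ssym] [s0 [sm _]]] := vn_symmetric_sqrt Dvn Dm mp.1 mp.2.
have Ms := DM Ds; have Msx := vn_comp Mvn Ms Mx.
have -> : rho (m \o x) = rho ((s \o x) \o s) by rewrite -sm -[_ \o x]/(s \o (s \o x)) wC.
apply: rho_ge0; first exact: vn_comp.
split=> [u v|u] /=; first by rewrite ssym xsym ssym.
by rewrite ssym.
Qed.

Lemma comp_linear_sub a x y : linear a -> a \o (x - y) = (a \o x) - (a \o y).
Proof.
by move=> al; apply/funext => u; change (a (x u - y u) = a (x u) - a (y u));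
   rewrite (rlB (linear_real_linear al)).
Qed.

(** * Truncation to the unit interval and minimisation *)

Section Truncation.
Variable x : H -> H.
Hypotheses (Mx : M x) (xp : psd_op x) (x1 : forall u, rip (x u) u <= nsq u).

(** For [a] in [D], the real part of [w ((a - x)^2) - w (x^2)]: the two cross terms agree by
    [wC]. *)
Definition sq_dist a := rho (a \o a) - 2 * rho (a \o x).

(** With [a = p - m], passing to [p] saves [rho (m \o m) + 2 * rho (m \o x)]. *)
Lemma truncate_below a : D a -> symmetric_op a ->
  exists b, [/\ D b, psd_op b & sq_dist b <= sq_dist a].
Proof.
move=> Da asym; have [p [m [[Dp pp] [Dm mp] aE pm0 mp0]]] := vn_pos_neg Dvn Da asym.
have [Mp Mm] := (DM Dp, DM Dm).
have pl := linear_real_linear (vn_linear Dvn Dp).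
have ml := linear_real_linear (vn_linear Dvn Dm).
exists p; split=> //.
have -> : sq_dist a = (rho (p \o p) + rho (m \o m)) - 2 * (rho (p \o x) - rho (m \o x)).
  rewrite /sq_dist -rhoD; [|exact: vn_comp..].
  rewrite -rhoB; [|exact: vn_comp..].
  congr (rho _ - 2 * rho _); apply/funext => u /=; rewrite !fctE /= aE//.
  by rewrite aE (rlB pl) (rlB ml) pm0 mp0 subr0 sub0r opprK.
have := rho_comp_ge0 Dm mp Mx xp; have := rho_comp_ge0 Dm mp Mm mp.
by rewrite /sq_dist; lra.
Qed.

(** With [1 - b = p - m], the element [k = 1 - p] is the minimum of [b] and 1, and [b = k + m]. As
    [k m = m k = m], passing to [k] saves [rho (m \o m) + 2 * rho (m \o (1 - x))], which is
    nonnegative because [x <= 1]. Positivity of [k] is [p <= 1], a consequence of [1 - b <= 1]. *)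
Lemma truncate_above b : D b -> psd_op b ->
  exists k, [/\ D k, psd_op k, forall u, rip (k u) u <= nsq u & sq_dist k <= sq_dist b].
Proof.
move=> Db [bsym b0]; have Di := vn_id Dvn; have Mi := DM Di.
have idsym : symmetric_op (idfun : H -> H) by [].
have [p [m [[Dp [psym p0]] [Dm mp] cE pm0 mp0]]] :=
  vn_pos_neg Dvn (vnB Dvn Di Db) (symmetricB idsym bsym).
have [Mp Mm] := (DM Dp, DM Dm); have Mb := DM Db.
have pl := linear_real_linear (vn_linear Dvn Dp).
have ml := linear_real_linear (vn_linear Dvn Dm).
have [C _ pC] := bounded_op_bound (vn_bounded Dvn Dp).
have p1 : forall u, rip (p u) u <= nsq u.
  apply: (positive_part_le1 psym pC mp0 cE) => u.
  by rewrite !fctE !(ipE hilbert_rip) gerBl.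
pose k : H -> H := idfun - p.
have Dk : D k by exact: vnB.
have Mk := DM Dk.
have bE u : b u = k u + m u.
  have := cE u; rewrite /k !fctE /= => h.
  have -> : b u = u - (u - b u) by rewrite opprB addrC subrK.
  by rewrite h opprB addrA addrAC.
have kl := linear_real_linear (vn_linear Dvn Dk).
have km u : k (m u) = m u by rewrite /k !fctE /= pm0 subr0.
have mk u : m (k u) = m u by rewrite /k !fctE /= (rlB ml) mp0 subr0.
exists k; split=> //.
- split; first exact: symmetricB.
  by move=> u; rewrite /k !fctE /= !(ipE hilbert_rip) subr_ge0.
- by move=> u; rewrite /k !fctE /= !(ipE hilbert_rip) gerBl.
have -> : sq_dist b = rho (k \o k) + rho m + rho m + rho (m \o m) -
    2 * (rho (k \o x) + rho (m \o x)).
  have [Mkk Mmm] := (vn_comp Mvn Mk Mk, vn_comp Mvn Mm Mm).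
  rewrite /sq_dist -!rhoD//; [|by do ?[exact: vn_comp|apply: (vnD Mvn)]..].
  congr (rho _ - 2 * rho _); apply/funext => u /=; rewrite !fctE /= bE//.
  by rewrite bE (rlD kl) (rlD ml) km mk addrA.
have xc : psd_op (idfun - x).
  split; first by apply: symmetricB => //; case: xp.
  by move=> u; rewrite !fctE /= !(ipE hilbert_rip) subr_ge0.
have := rho_comp_ge0 Dm mp (vnB Mvn Mi Mx) xc.
rewrite comp_linear_sub; last exact: (vn_linear Dvn).
rewrite rhoB; [|exact: vn_comp..].
have := rho_comp_ge0 Dm mp Mm mp; rewrite /sq_dist.
by rewrite -[m \o idfun]/m; lra.
Qed.

Lemma conditional_expectation_contraction :
  exists h, [/\ D h, psd_op h & forall d, D d -> w (x \o d) = w (h \o d)].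
Proof.
pose K := [set h : H -> H | [/\ D h, psd_op h & forall u, rip (h u) u <= nsq u]].
have distE a : D a -> symmetric_op a ->
    nsq2 (e a) - 2 * rip2 (e a) (e x) = sq_dist a.
  move=> Da asym; have Ma := DM Da.
  by rewrite rip2_rho// (ipC hilbert_rip2) rip2_rho.
have Db d : D d -> bounded_op d by exact: vn_bounded.
pose half : R[i] := (2^-1)%:C.
have [|||h [l [hK hl hmin]]] := @minimizing_sequence R ell2 ip2 hilbert_rip2 _ K
    (fun a b => half *: (a + b)) (fun a => e a)
    (fun a => rip2 (e a) (e x)) (- nsq2 (e x)).
- exists 0; split; first exact: vn_0.
    split=> [u v|u]; first by rewrite (ip0r hilbert_rip) (ip0l hilbert_rip).
    by rewrite (ip0l hilbert_rip).
  by move=> u; rewrite (ip0l hilbert_rip) (ip_ge0 hilbert_rip).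
- move=> a b [Da [asym a0] a1] [Db' [bsym b0] b1].
  have Dab := vnD Dvn Da Db'; have Dh := vnZ Dvn half Dab.
  have eE : e (half *: (a + b)) = half *: (e a + e b).
    by rewrite hatZ ?hatD//; exact: Db.
  split=> //; last by rewrite eE !(ipE hilbert_rip2) mulrC.
  split=> //.
    split=> [u v|u]; rewrite !fctE !(ipE hilbert_rip); first by rewrite asym bsym.
    by have := a0 u; have := b0 u; lra.
  by move=> u; rewrite !fctE !(ipE hilbert_rip); have := a1 u; have := b1 u; lra.
- move=> a [Da _ _]; have := ip_ge0 hilbert_rip2 (e a - e x).
  by rewrite !(ipE hilbert_rip2) (ipC hilbert_rip2 (e x)); lra.
have [k [Dk kp kl]] := strong_limit hK hl.
have Mk := DM Dk; have Mxk := vnB Mvn Mx Mk.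
pose G xi := nsq2 xi - 2 * rip2 xi (e x).
(* Minimality within [K] alone would not allow the variations [k + t a]; truncation extends it to
   all self-adjoint elements of [D]. *)
have lmin a : D a -> symmetric_op a -> G l <= G (e a).
  move=> Da asym; have [b [Db' bp bd]] := truncate_below Da asym.
  have [c [Dc cp c1 cd]] := truncate_above Db' bp.
  apply: (@cvgn_le _ (fun n => G (e (h n))) (fun n => G (e a) + n.+1%:R^-1)).
  - move=> n; have Kc : K c by [].
    apply: le_trans (hmin n c Kc) _; rewrite lerD2r /G !distE//; first exact: le_trans cd bd.
    by case: cp.
  - apply: cvgB; first exact: (hconv_nsq hilbert_rip2 hl).
    by apply: cvgM; [exact: cvg_cst|exact: (hconv_ip hilbert_rip2 hl)].
  - rewrite -[X in _ --> X]addr0; apply: cvgD; first exact: cvg_cst.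
    exact: cvg_harmonic.
have rho_eq a : D a -> symmetric_op a -> rho (a \o (x - k)) = 0.
  move=> Da asym; have Ma := DM Da.
  (* [G (e (t a + k)) - G l] is a nonnegative quadratic in [t] without constant term, so its linear
     coefficient vanishes. *)
  have : (rip2 l (e a) - rip2 (e a) (e x)) ^+ 2 <= 0 * nsq2 (e a).
    apply: discriminant_le0 => t.
    have Dka : D (t%:C *: a + k) by exact: vn_lin.
    have kasym : symmetric_op (t%:C *: a + k).
      by move=> u v; rewrite !fctE !(ipE hilbert_rip) asym kp.1.
    have := lmin _ Dka kasym; rewrite /G hatL; [|exact: Db..].
    rewrite kl !(ipE hilbert_rip2) (ipC hilbert_rip2 (e a) l); lra.
  rewrite mul0r => sq0.
  have /eqP : (rip2 l (e a) - rip2 (e a) (e x)) ^+ 2 = 0.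
    by apply/eqP; rewrite eq_le sq0 sqr_ge0.
  rewrite sqrf_eq0 subr_eq0 -kl => /eqP eq_rip.
  rewrite comp_linear_sub; last exact: (vn_linear Dvn).
  rewrite rhoB; [|exact: vn_comp..].
  by rewrite -!rip2_rho// eq_rip (ipC hilbert_rip2) subrr.
have rho_eq2 d : D d -> rho (d \o (x - k)) = 0.
  move=> Dd; have [d' Dd' dd'] := vn_adjoint Dvn Dd.
  have [Md Md'] := (DM Dd, DM Dd').
  have ysym : symmetric_op (x - k) by apply: symmetricB; [case: xp|case: kp].
  (* By [wC] the left side is the value at the adjoint of [d \o (x - k)], hence has the same real
     part; the self-adjoint [d + d'] then gives twice the wanted value. *)
  have h1 : rho (d' \o (x - k)) = rho (d \o (x - k)).
    rewrite wC//; apply: (functional_adjoint Mvn wL w0); do ?exact: vn_comp.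
    have /symmetric_adjoint := ysym => /(_ (vn_linear Mvn Mxk)) yadj.
    by move=> u v /=; rewrite dd' yadj.
  have dsym : symmetric_op (d + d').
    move=> u v; rewrite !fctE !(ipE hilbert_rip) (is_adjoint_rip _ _ dd').
    by rewrite (is_adjoint_rip _ _ (is_adjoint_sym dd')) addrC.
  have := rho_eq _ (vnD Dvn Dd Dd') dsym.
  rewrite -[_ \o _]/((d \o (x - k)) + (d' \o (x - k))).
  rewrite rhoD; do ?exact: vn_comp.
  by rewrite h1; lra.
exists k; split=> // d Dd; have Md := DM Dd.
(* The imaginary part is obtained from the real part at [ii *: d]. *)
have w_eq : w (d \o (x - k)) = 0.
  have := rho_eq2 _ (vnZ Dvn ii Dd).
  rewrite -[_ \o _]/(ii *: (d \o (x - k))) (functionalZ Mvn wL); last exact: vn_comp.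
  have := rho_eq2 _ Dd; case: (w _) => p q /= ->.
  by rewrite mul0r mul1r sub0r => /eqP; rewrite oppr_eq0 => /eqP->.
rewrite -(wC Dd Mx) -(wC Dd Mk); move: w_eq; rewrite comp_linear_sub; last exact: (vn_linear Dvn).
rewrite (functionalD wL); do ?[exact: vn_comp|apply: (vnN Mvn)].
rewrite -scaleN1r (functionalZ Mvn wL); last exact: vn_comp.
by rewrite mulN1r => /eqP; rewrite subr_eq0 => /eqP.
Qed.

End Truncation.

(** A linear relation rather than a map: existence is first shown for positive contractions and then
    extended by linearity, before any choice of [E] is made. *)
Definition is_expectation x h := D h /\ forall d, D d -> w (x \o d) = w (h \o d).

Lemma is_expectation_lin (k : R[i]) x y h g : M x -> M y ->
  is_expectation x h -> is_expectation y g ->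
  is_expectation (k *: x + y) (k *: h + g).
Proof.
move=> Mx My [Dh hx] [Dg gy]; split; first exact: vn_lin.
move=> d Dd; have Md := DM Dd; have [Mh Mg] := (DM Dh, DM Dg).
rewrite -[LHS]/(w (k *: (x \o d) + (y \o d))) -[RHS]/(w (k *: (h \o d) + (g \o d))).
by rewrite !wL ?hx ?gy//; exact: vn_comp.
Qed.

(** Testing against the adjoint [b] of [h - g] gives [w ((h - g) b) = 0]. Faithfulness on [D] yields
    [(h - g) b = 0], hence [b = 0]. *)
Lemma is_expectation_unique x h g : is_expectation x h -> is_expectation x g -> h = g.
Proof.
move=> [Dh hx] [Dg gx]; have Dhg := vnB Dvn Dh Dg.
have [b Db hb] := vn_adjoint Dvn Dhg; have Mb := DM Db.
have bE v : (h - g) (b v) = 0.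
  apply: (psd_faithful (x := (h - g) \o b)); first exact: vn_comp.
    have hb' := is_adjoint_sym hb; split=> [u z|u] /=.
      by rewrite (is_adjoint_rip _ _ hb) -(is_adjoint_rip _ _ hb').
    by rewrite (is_adjoint_rip _ _ hb) (ip_ge0 hilbert_rip).
  rewrite -[_ \o b]/((h \o b) - (g \o b)) rhoB; do ?by apply: vn_comp => //; exact: DM.
  by rewrite -hx// -gx// subrr.
have b0 v : b v = 0.
  apply: (ip_eq0 hilbert_rip); rewrite -(is_adjoint_rip _ _ hb) bE.
  exact: (ip0l hilbert_rip).
apply/eqP; rewrite -subr_eq0; apply/eqP/funext => u; apply: rip_inj => v.
by rewrite (is_adjoint_rip _ _ hb) b0 (ip0r hilbert_rip) (ip0l hilbert_rip).
Qed.

Lemma is_expectation_self d : D d -> is_expectation d d.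
Proof. by split. Qed.

Lemma rip_op_le x : bounded_op x -> exists2 C, 0 < C & forall u, `|rip (x u) u| <= C * nsq u.
Proof.
move=> /bounded_op_bound[C C0 xC]; exists (C + 1) => [|u]; first by rewrite addr_gt0.
apply: le_trans (rip_normr_le _ _) _; have := xC u; lra.
Qed.

Lemma expectation_psd x : M x -> psd_op x ->
  exists2 h, is_expectation x h & psd_op h.
Proof.
move=> Mx [xsym x0]; have [C C0 xC] := rip_op_le (vn_bounded Mvn Mx).
pose y := (C^-1)%:C *: x; have My : M y by exact: vnZ.
have yp : psd_op y.
  split=> [u v|u]; rewrite /y !fctE !(ipE hilbert_rip); first by rewrite xsym.
  by rewrite mulr_ge0// invr_ge0 ltW.
have y1 u : rip (y u) u <= nsq u.
  rewrite /y !fctE !(ipE hilbert_rip) ler_pdivrMl//.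
  exact: le_trans (ler_norm _) (xC u).
have [h [Dh [hsym h0] hy]] := conditional_expectation_contraction My yp y1.
exists (C%:C *: h); last first.
  split=> [u v|u]; rewrite !fctE !(ipE hilbert_rip); first by rewrite hsym.
  by rewrite mulr_ge0// ltW.
have := is_expectation_lin C%:C My (vn_0 Mvn) (conj Dh hy)
  (is_expectation_self (vn_0 Dvn)).
rewrite !addr0 /y scalerA -rmorphM /= divff ?gt_eqF//.
by rewrite scale1r.
Qed.

(** Adding [C] times the identity makes [x] positive; linearity of the relation takes it away
    again. *)
Lemma expectation_symmetric x : M x -> symmetric_op x -> exists h, is_expectation x h.
Proof.
move=> Mx xsym; have [C C0 xC] := rip_op_le (vn_bounded Mvn Mx).
have [Mi Di] := (vn_id Mvn, vn_id Dvn).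
pose y : H -> H := C%:C *: idfun + x.
have My : M y by exact: vn_lin.
have [|h hy _] := expectation_psd My.
  split=> [u v|u]; rewrite /y !fctE !(ipE hilbert_rip); first by rewrite xsym.
  by have := xC u; rewrite ler_norml => /andP[+ _]; rewrite /idfun; lra.
exists ((- C)%:C *: idfun + h).
have := is_expectation_lin (- C)%:C Mi My (is_expectation_self Di) hy.
rewrite /y addrA -scalerDl -rmorphD /= addNr.
by rewrite (_ : 0%:C = 0 :> R[i])// scale0r add0r.
Qed.

Lemma expectation_exists x : M x -> exists h, is_expectation x h.
Proof.
move=> Mx; have [x' Mx' xx'] := vn_adjoint Mvn Mx.
have xx's := is_adjoint_sym xx'.
have Ms := vnD Mvn Mx Mx'.
have [|h hs] := expectation_symmetric Ms.
  move=> u v; rewrite !fctE !(ipE hilbert_rip) (is_adjoint_rip _ _ xx').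
  by rewrite (is_adjoint_rip _ _ xx's) addrC.
pose b := (- ii) *: (x - x').
have Mb : M b by apply: vnZ => //; exact: vnB.
have [|g gb] := expectation_symmetric Mb.
  exact: (adjoint_difference_symmetric Mvn).
have [h2 h2P] : exists h2, is_expectation (ii *: b + (x + x')) h2.
  by exists (ii *: g + h); exact: is_expectation_lin.
have xE : (2^-1)%:C *: (ii *: b + (x + x')) = x.
  rewrite /b scalerA mulrN -expr2 sqr_i opprK scale1r addrACA addNr addr0.
  rewrite scalerDr -scalerDl -rmorphD /=.
  have -> : 2^-1 + 2^-1 = 1 :> R by field.
  by rewrite scale1r.
exists ((2^-1)%:C *: h2).
have := is_expectation_lin (2^-1)%:C (vn_lin Mvn ii Mb Ms) (vn_0 Mvn) h2P
  (is_expectation_self (vn_0 Dvn)).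
by rewrite !addr0 xE.
Qed.

(** * Normality *)

Section Normality.
Variable E : (H -> H) -> (H -> H).
Hypotheses (EL : linear_on M E) (ED : forall x, M x -> D (E x)).
Hypothesis E0 : forall x, M x -> positive_op x -> positive_op (E x).
Hypotheses (E1 : E idfun = idfun) (Ew : forall x, M x -> w (E x) = w x).

Let Epsd x : M x -> psd_op x -> psd_op (E x).
Proof.
move=> Mx xp; have := E0 Mx (psd_positive Mx xp).
by move/(positive_opP (vn_linear Dvn (ED Mx))).
Qed.

Let Eb x : M x -> bounded_op (E x).
Proof. by move=> Mx; exact: (vn_bounded Dvn (ED Mx)). Qed.

Let phi u x : R[i]^o := hdot (E x u) u.

Let phiL u : linear_on M (phi u).
Proof. by move=> k x y Mx My; rewrite /phi EL// !fctE hdotL. Qed.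

Let phi0 u x : M x -> positive_op x -> 0 <= phi u x :> R[i].
Proof. by move=> Mx xp; exact: E0. Qed.

Let normal_vector u := exists c : ell2, forall x, M x -> positive_op x ->
  Re (phi u x) <= vecfun c x.

Let represented u : normal_vector u -> exists c : ell2,
  forall x, M x -> rip (E x u) u = vecfun c x.
Proof.
by move=> [c uc]; have [d [_ hd]] := dominated_predual Mvn (@phiL u) (@phi0 u) uc;
   exists d.
Qed.

(** Evaluation at the identity. The exact norm keeps families of such vectors [c]
    square-summable. *)
Let represented_norm u (c : ell2) : (forall x, M x -> rip (E x u) u = vecfun c x) ->
  nsq2 c = nsq u.
Proof. by move=> h; have := h _ (vn_id Mvn); rewrite E1 /vecfun hat_id => <-. Qed.

(** Iterates [<a (v + s), v + s> <= 2 <a v, v> + 2 <a s, s>], which accounts for the weights. *)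
Let psd_sum_le a (v : nat -> H) n : D a -> psd_op a ->
  rip (a (\sum_(0 <= m < n) v m)) (\sum_(0 <= m < n) v m) <=
  \sum_(0 <= m < n) 2 ^+ m.+1 * rip (a (v m)) (v m).
Proof.
move=> Da [asym a0]; have al := linear_real_linear (vn_linear Dvn Da).
elim: n v => [|n ih] v; first by rewrite !big_geq// (ip0r hilbert_rip).
rewrite !big_nat_recl//=; set s := \sum_(_ <= _ < _) v _.
have := ih (fun m => v m.+1); rewrite -/s => hs.
have h2 : \sum_(0 <= m < n) 2 ^+ m.+2 * rip (a (v m.+1)) (v m.+1) =
    2 * \sum_(0 <= m < n) 2 ^+ m.+1 * rip (a (v m.+1)) (v m.+1).
  by rewrite mulr_sumr; apply: eq_bigr => m _; rewrite mulrA -exprS.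
rewrite h2 expr1; have := a0 (v 0%N - s).
rewrite !(rlD al) (rlN al) !(ipE hilbert_rip) (asym s (v 0%N)) (ipC hilbert_rip s).
by move: hs; lra.
Qed.

(** The factor [r] absorbs the weights of [psd_sum_le] into the representing vectors. *)
Let state_bounded_normal r u : 0 <= r -> state_bounded u ->
  exists c : ell2, (forall x, M x -> r * rip (E x u) u = vecfun c x) /\
    nsq2 c = r * nsq u.
Proof.
move=> r0 [C uC].
have [|c uc] := @represented u.
  exists ((Num.sqrt `|C|)%:C *: zeta) => x Mx xp.
  have xpsd : psd_op x by move/(positive_opP (vn_linear Mvn Mx)): xp.
  rewrite vecfunZ ?sqr_sqrtr//; last exact: (vn_bounded Mvn Mx).
  have rE : rho (E x) = vecfun zeta x by rewrite Ew// wzeta.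
  apply: le_trans (uC _ (ED Mx) (Epsd Mx xpsd)) _.
  by rewrite rE ler_wpM2r ?ler_norm// vecfun_ge0//; exact: (vn_bounded Mvn Mx).
exists ((Num.sqrt r)%:C *: c); split=> [x Mx|].
  by rewrite uc// vecfunZ ?sqr_sqrtr//; exact: (vn_bounded Mvn Mx).
by rewrite (nsqZ hilbert_rip2) sqr_sqrtr// (represented_norm uc).
Qed.

Let geometric_sum_le N : \sum_(0 <= m < N) (4^-1 : R) ^+ m <= 2.
Proof.
suff : \sum_(0 <= m < N) (4^-1 : R) ^+ m <= 4 / 3 - 4 / 3 * 4^-1 ^+ N.
  have : 0 <= (4^-1 : R) ^+ N by rewrite exprn_ge0// invr_ge0.
  lra.
elim: N => [|N ih]; first by rewrite big_geq// expr0; lra.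
by rewrite big_nat_recr//= exprS; lra.
Qed.

(* Write [u] as a rapidly converging sum of state-bounded vectors: the functional
   of [u] is then dominated by a sum of normal functionals with summable norms. *)
Let all_normal u : normal_vector u.
Proof.
(* The rate [8^-m] beats the weights: [nsq (d m.+1) <= 4 * 8^-m], so the weighted norms are at most
   [2^(m+2) * 4 * 8^-m = 16 * 4^-m], with sum at most 32. *)
have /choice[v vP] m : exists v, state_bounded v /\ nsq (v - u) <= 8^-1 ^+ m.
  have [x [xS /cvgr0Pnorm_lt xu]] := state_bounded_dense u.
  have [|N _ /(_ N (leqnn _)) hN] := xu (8^-1 ^+ m).
    by rewrite exprn_gt0// invr_gt0.
  by exists (x N); split=> //; apply: ltW; exact: le_lt_trans (ler_norm _) hN.
pose d m := if m is n.+1 then v n.+1 - v n else v 0%N.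
have dS m : state_bounded (d m).
  case: m => [|m]; first by case: (vP 0%N).
  have [_ sub] := state_bounded_sub; have [h1 _] := vP m; have [h2 _] := vP m.+1.
  by have := sub (-1) _ _ h1 h2; rewrite rmorphN scaleN1r addrC.
have dsum N : \sum_(0 <= m < N.+1) d m = v N.
  elim: N => [|N ih]; first by rewrite big_nat1.
  by rewrite big_nat_recr//= ih addrC subrK.
have dn m : nsq (d m.+1) <= 4 * 8^-1 ^+ m.
  have := nsqB_le hilbert_rip u (v m.+1) (v m).
  have [_ h1] := vP m; have [_ h2] := vP m.+1.
  have e0 : 0 <= (8^-1 : R) ^+ m by rewrite exprn_ge0// invr_ge0.
  by move: h2; rewrite exprS => h2 h3; apply: le_trans h3 _; lra.
have /choice[c cP] m : exists c : ell2,
    (forall x, M x -> 2 ^+ m.+1 * rip (E x (d m)) (d m) = vecfun c x) /\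
    nsq2 c = 2 ^+ m.+1 * nsq (d m).
  by apply: state_bounded_normal => //; rewrite exprn_ge0.
have [N|b hb] := @vecfun_dominated_sum _ _ c (2 * nsq (d 0%N) + 32).
  have step K : \sum_(0 <= m < K.+1) nsq2 (c m) <= 2 * nsq (d 0%N) + 32.
    rewrite big_nat_recl//= (cP 0).2 expr1 lerD2l.
    apply: (@le_trans _ _ (\sum_(0 <= m < K) 16 * 4^-1 ^+ m)).
      apply: ler_sum => m _; rewrite (cP _).2.
      apply: (@le_trans _ _ (2 ^+ m.+2 * (4 * 8^-1 ^+ m))).
        by rewrite ler_wpM2l// exprn_ge0.
      have -> : (4^-1 : R) ^+ m = 2 ^+ m * 8^-1 ^+ m.
        by rewrite -exprMn; congr (_ ^+ _); field.
      by rewrite !exprS; lra.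
    by rewrite -mulr_sumr; have := geometric_sum_le K; lra.
  apply: le_trans (step N); rewrite big_nat_recr//= lerDl.
  exact: (ip_ge0 hilbert_rip2).
exists b => x Mx xp; have xb := vn_bounded Mvn Mx.
have xpsd : psd_op x by move/(positive_opP (vn_linear Mvn Mx)): xp.
have vu : hconv (@rip R H) v u.
  have e8 : (8^-1 : R) ^+ n @[n --> \oo] --> (0 : R).
    by apply: cvg_expr; rewrite ger0_norm ?invr_ge0// invf_lt1// ltr1n.
  apply: (hconv_le hilbert_rip (C := 1) _ e8) => n.
  by rewrite mul1r; case: (vP n).
have [C _ EC] := bounded_op_bound (Eb Mx).
have El := linear_real_linear (bounded_op_linear (Eb Mx)).
have Ev : hconv (@rip R H) (E x \o v) (E x u).
  by apply: (hconv_map hilbert_rip _ EC vu) => y z; exact: rlB.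
apply: (cvgr_to_le (hconv_ip2 hilbert_rip Ev vu)); near=> n.
rewrite /= -dsum; apply: le_trans (psd_sum_le _ _ (ED Mx) (Epsd Mx xpsd)) _.
apply: le_trans (hb x xb xpsd n.+1).
by rewrite le_eqVlt; apply/orP; left; apply/eqP/eq_bigr => m _; rewrite (cP m).1.
Unshelve. all: by end_near. Qed.

(** The complex inner product of [ell2], recovered from its real part. *)
Let hdot2 (xi eta : ell2) : R[i]^o := Complex (rip2 xi eta) (rip2 xi (ii *: eta)).

Let rip2_complexZ (k : R[i]) (xi eta : ell2) :
  rip2 (k *: xi) eta = Re k * rip2 xi eta - Im k * rip2 xi (ii *: eta).
Proof.
case: k => p q.
have -> : Complex p q *: xi = p%:C *: xi + q%:C *: (ii *: xi) :> ell2.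
  by rewrite scalerA -scalerDl {1}[Complex p q]complexE /= [ii * _]mulrC.
by rewrite !(ipE hilbert_rip2) rip2_ii mulrN.
Qed.

Let rip2_iiii (xi eta : ell2) : rip2 xi (ii *: (ii *: eta)) = - rip2 xi eta.
Proof. by rewrite scalerA -expr2 sqr_i scaleN1r (ipNr hilbert_rip2). Qed.

Let hdot2L (k : R[i]) (xi eta theta : ell2) :
  hdot2 (k *: xi + eta) theta = k * hdot2 xi theta + hdot2 eta theta.
Proof.
rewrite /hdot2 !(ipDl hilbert_rip2) !rip2_complexZ rip2_iiii.
by case: k => p q /=; congr Complex; ring.
Qed.

(** Each coordinate of [xi] is represented by a vector [c n] of the same norm, so the [c n] have
    summable squares and merge into one dominating [b]; domination is then upgraded to equality. *)
Let quadratic_predual (xi : ell2) : exists c : ell2, forall x, M x ->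
  hdot2 (hat (E x) xi) xi = predual_functional (l2val c, l2val c) x.
Proof.
have /choice[c cP] n := represented (all_normal (xi n)).
have cn n : nsq2 (c n) = nsq (xi n) by exact: represented_norm (cP n).
have [N|b hb] := @vecfun_dominated_sum _ _ c (nsq2 xi).
  by under eq_bigr do rewrite cn; exact: nsq2_ge.
have [|||d [dE _]] := @dominated_predual _ _ M
  (fun x => hdot2 (hat (E x) xi) xi) b Mvn.
- move=> k x y Mx My; rewrite EL// hatL; [|exact: Eb..].
  exact: hdot2L.
- move=> x Mx xp; have xpsd : psd_op x by move/(positive_opP (vn_linear Mvn Mx)): xp.
  have Exp := E0 Mx xp.
  have im0 : rip2 (hat (E x) xi) (ii *: xi) = 0.
    apply: rip2_unique; apply: (eq_cvgn (f := fun=> 0)); last exact: cvg_cst.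
    move=> n; apply: esym; apply: big1 => k _; rewrite hatE; last exact: Eb.
    by rewrite l2valZ; have := Exp (xi k); rewrite hdotE lecE /= => /andP[/eqP].
  rewrite /hdot2 im0 ler0c; exact: (vecfun_ge0 xi (Eb Mx) (Epsd Mx xpsd)).
- move=> x Mx xp; have xpsd : psd_op x by move/(positive_opP (vn_linear Mvn Mx)): xp.
  apply: (cvgr_to_le (@rip2_cvg _ _ (hat (E x) xi) xi)); near=> n.
  apply: le_trans (hb x (vn_bounded Mvn Mx) xpsd n).
  rewrite le_eqVlt; apply/orP; left; apply/eqP/eq_bigr => m _.
  by rewrite -cP// hatE//; exact: Eb.
by exists d.
Unshelve. all: by end_near. Qed.

Let polarization (y : H -> H) (xi eta : ell2) : bounded_op y ->
  hdot2 (hat y xi) eta = 4^-1 *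
   ((hdot2 (hat y (xi + eta)) (xi + eta) - hdot2 (hat y (xi - eta)) (xi - eta)) +
    ii * (hdot2 (hat y (xi + ii *: eta)) (xi + ii *: eta) -
          hdot2 (hat y (xi - ii *: eta)) (xi - ii *: eta))).
Proof.
move=> yb; have yl := linear_real_linear (hat_linear yb).
have yii := linearZ_op ii eta (hat_linear yb).
have i4 : (4^-1 : R[i]) = Complex 4^-1 0.
  by rewrite -[RHS]/((4^-1)%:C) fmorphV rmorph_nat.
rewrite i4 /hdot2 !(rlD yl) !(rlN yl) yii !scalerBr !scalerDr.
rewrite !(ipE hilbert_rip2) !rip2_ii !rip2_iiii.
by congr Complex => /=; field.
Qed.

(** By polarisation, a predual functional composed with [E] agrees on [M] with a combination [g] of
    four predual functionals. [g] is continuous everywhere, and agreement on [M] is enough for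
    continuity within [M]. *)
Lemma expectation_normal : normal_map M E.
Proof.
apply/subspace_continuousP => x Mx; apply: weak_star_cvg => i.
have [/sq_summableP h1 /sq_summableP h2] := svalP i.
pose xi := to_ell2 (sval i).1; pose eta := to_ell2 (sval i).2.
have iE : sval i = (l2val xi, l2val eta).
  by rewrite /xi /eta !to_ell2E//; case: (sval i).
have [c1 hc1] := quadratic_predual (xi + eta).
have [c2 hc2] := quadratic_predual (xi - eta).
have [c3 hc3] := quadratic_predual (xi + ii *: eta).
have [c4 hc4] := quadratic_predual (xi - ii *: eta).
pose pf (c : ell2) y : R[i]^o := predual_functional (l2val c, l2val c) y.
pose g y : R[i]^o := 4^-1 * ((pf c1 y - pf c2 y) + ii * (pf c3 y - pf c4 y)).
have gE y : M y -> predual_functional (sval i) (E y) = g y.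
  move=> My; have Eyb := Eb My.
  rewrite iE predual_functionalE// -/(hdot2 _ _) polarization//.
  by rewrite hc1// hc2// hc3// hc4.
have pfc (c : ell2) : continuous (pf c : weak_star H -> R[i]^o).
  have csum : sq_summable (l2val c) by apply/sq_summableP; exact: l2val_summable.
  exact: (@predual_continuous _ _ (exist _ (l2val c, l2val c) (conj csum csum))).
rewrite gE//.
have gc (F : set_system (H -> H)) : Filter F ->
    (forall c : ell2, pf c y @[y --> F] --> pf c x) -> g y @[y --> F] --> g x.
  move=> FF hF; apply: cvgM; first exact: cvg_cst.
  apply: cvgD; first exact: cvgB.
  by apply: cvgM; [exact: cvg_cst|exact: cvgB].
move=> A hA; have {}gc := gc _ (nbhs_filter (x : weak_star H)) (fun c => pfc c x) A hA.
have sub : g @^-1` A `<=`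
    [set y | M y -> A (predual_functional (sval i) (E y))].
  by move=> y /= Ay My; rewrite gE.
exact: (@filterS _ _ (nbhs_filter (x : weak_star H)) _ _ sub gc).
Qed.

End Normality.

End FaithfulState.

End Operators.

Theorem theorem3p5 (R : realType) (H : hilbertType R) (M D : set (H -> H))
    (w : (H -> H) -> R[i]^o) :
  von_neumann_algebra M -> von_neumann_subalgebra D M ->
  normal_state M w -> faithful_on D w -> tracial_on D w ->
  [/\ (forall d x, D d -> M x -> w (d \o x) = w (x \o d)) <->
        (exists E, preserving_normal_expectation M D w E),
      (forall E F, preserving_normal_expectation M D w E ->
         preserving_normal_expectation M D w F ->
         forall x, M x -> E x = F x) &
      (forall E, preserving_normal_expectation M D w E ->
         faithful_on M w -> faithful_on M E)].
Proof.
move=> Mvn [Dvn DM] [[wL w0 w1] wN] wD wT.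
have [c wc] := normal_dominated Mvn wL wN.
have [zeta [_ wzeta]] := dominated_predual Mvn wL w0 wc.
have uniq x h g : is_expectation D w x h -> is_expectation D w x g -> h = g.
  exact: (is_expectation_unique Mvn Dvn DM wL w0 wD).
(* [w (x d) = w (E (x d)) = w (E x d)], so every preserving expectation solves the characterising
   relation. *)
have pres E x : preserving_normal_expectation M D w E -> M x ->
    is_expectation D w x (E x).
  move=> [[[_ ED] _ _ _ Emod] _ Ew] Mx; split; first by rewrite -ED; exists x.
  move=> d Dd; have [_ Exd] := Emod d x Dd Mx.
  by rewrite -Exd Ew//; apply: vn_comp => //; exact: DM.
split; first split.
(* On [M] a solution exists, so the default [0] of [xget] does not intervene there. Linearity,
   positivity and both module laws of [E] follow from [uniq]. *)
- move=> wC; pose E x := xget 0 [set h | is_expectation D w x h].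
  have EP x : M x -> is_expectation D w x (E x).
    move=> Mx; rewrite /E; case: xgetP => [h _ //|nh].
    have [h hx] := expectation_exists Mvn Dvn DM wL w0 wD wzeta wC Mx.
    by case: (nh h).
  have ED x : M x -> D (E x) by move=> /EP[].
  have EDid d : D d -> E d = d.
    by move=> Dd; apply: (uniq d); [apply/EP/DM|exact: is_expectation_self].
  have EL : linear_on M E.
    move=> k x y Mx My; apply: (uniq (k *: x + y)).
      by apply: EP; exact: vn_lin.
    have h := is_expectation_lin Mvn Dvn DM wL k Mx My (EP x Mx) (EP y My).
    exact: h.
  have E0 x : M x -> positive_op x -> positive_op (E x).
    move=> Mx /(positive_opP (vn_linear Mvn Mx)) xp.
    have [h hx hp] := expectation_psd Mvn Dvn DM wL w0 wD wzeta wC Mx xp.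
    rewrite (uniq _ _ _ (EP x Mx) hx).
    by apply/(positive_opP (vn_linear Dvn _)) => //; case: hx.
  have E1 : E idfun = idfun by apply: EDid; exact: vn_id.
  have Ew x : M x -> w (E x) = w x.
    by move=> Mx; have [_ /(_ _ (vn_id Dvn))] := EP x Mx.
  exists E; split; last exact: Ew; last first.
    exact: (expectation_normal Mvn Dvn DM w0 wD wzeta EL ED E0 E1 Ew).
  split=> //.
  + split=> //; apply/seteqP; split=> [_ [x Mx <-]|d Dd]; first exact: ED.
    by exists d; [exact: DM|exact: EDid].
  + by move=> x Mx; apply: EDid; exact: ED.
  + move=> d x Dd Mx; have [DE hx] := EP x Mx; have Md := DM _ Dd; split.
      apply: (uniq (d \o x)); first by apply: EP; exact: vn_comp.
      split=> [|a Da]; first exact: vn_comp.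
      have Ma := DM _ Da.
      (* [w (d x a) = w (x a d) = w (E x a d) = w (d E x a)]; the last equality is traciality on
         [D]. *)
      have := wC _ _ Dd (vn_comp Mvn Mx Ma); have := hx _ (vn_comp Dvn Da Dd).
      have := wT _ _ Dd (vn_comp Dvn DE Da).
      by rewrite /comp /= => -> -> ->.
    apply: (uniq (x \o d)); first by apply: EP; exact: vn_comp.
    split=> [|a Da]; first exact: vn_comp.
    by rewrite -[_ \o a]/(x \o (d \o a)) hx//; exact: vn_comp.
(* [w (d x) = w (E (d x)) = w (d E x) = w (E x d) = w (x d)], with traciality in the third
   equality. *)
- move=> [E EP] d x Dd Mx; have Md := DM _ Dd.
  have [DE hx] := pres E x EP Mx; have [[_ _ _ _ Emod] _ Ew] := EP.
  have [Edx _] := Emod d x Dd Mx.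
  rewrite hx// -Ew; last exact: vn_comp.
  by rewrite Edx wT.
- move=> E F EP FP x Mx; by apply: (uniq x); exact: pres.
- move=> E [_ _ Ew] wF x Mx xp Ex; apply: wF => //.
  rewrite -Ew// Ex; have := functionalZ Mvn wL 0 (vn_0 Mvn).
  by rewrite scale0r mul0r.
Qed.
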